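(* Let $\Gamma_1$ and $\Gamma_2$ be groups. Then $\Gamma_1$ and $\Gamma_2$ are (both) CAT(0) groups if and only if $\Gamma_1\times \Gamma_2$ is a CAT(0) group.
   Context: A group $\Gamma$ is called a CAT(0) group if $\Gamma$ acts geometrically on some CAT(0) space. A geometric action of $\Gamma$ on a CAT(0) space $X$ is an action by isometries that is proper (every $x\in X$ has some $r>0$ such that $\{\gamma\in\Gamma : \gamma B(x,r)\cap B(x,r)\ne\emptyset\}$ is finite) and cocompact (there is a compact $K\subset X$ with $\Gamma K=X$). CAT(0) spaces are understood to be non-empty. *)

(* Defs.v *)
From HB Require Import structures.
From mathcomp Require Import all_boot all_order all_algebra.
From mathcomp Require Import all_classical all_reals all_analysis.

Set Implicit Arguments.
Unset Strict Implicit.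
Unset Printing Implicit Defensive.

Import Order.TTheory GRing.Theory Num.Theory.
Import numFieldNormedType.Exports.

Local Open Scope classical_set_scope.
Local Open Scope ring_scope.

(* The library's own metric on 'rV[R]_2 is the one of the sup norm. *)
Definition euclidean_dist (R : realType) (p q : 'rV[R]_2) : R :=
  Num.sqrt (\sum_(i < 2) (p ord0 i - q ord0 i) ^+ 2).

(* The distance is an explicit argument, so that the definition applies both to
   a [metricType] and to the plane with [euclidean_dist].  A geodesic is an
   isometric embedding of [0, d x y], represented by a function on R whose
   values outside that interval are irrelevant. *)
Definition is_geodesic (R : realType) (T : Type) (d : T -> T -> R)
    (x y : T) (c : R -> T) : Prop :=
  [/\ c 0 = x, c (d x y) = y &
      forall s t, 0 <= s <= d x y -> 0 <= t <= d x y ->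
        d (c s) (c t) = `|s - t|].

Definition geodesic_space (R : realType) (X : metricType R) : Prop :=
  forall x y : X, exists c : R -> X, is_geodesic mdist x y c.

(* The side [c i] joins [v i] to [v (ordS i)], where [ordS] is the cyclic
   successor on 'I_3. *)
Definition geodesic_triangle (R : realType) (T : Type) (d : T -> T -> R)
    (v : 'I_3 -> T) (c : 'I_3 -> R -> T) : Prop :=
  forall i, is_geodesic d (v i) (v (ordS i)) (c i).

Definition comparison_triangle (R : realType) (X : metricType R)
    (v : 'I_3 -> X) (v' : 'I_3 -> 'rV[R]_2) (c' : 'I_3 -> R -> 'rV[R]_2) :
    Prop :=
  geodesic_triangle (@euclidean_dist R) v' c' /\
  forall i, euclidean_dist (v' i) (v' (ordS i)) = mdist (v i) (v (ordS i)).

(* A point of the triangle is [c i s] with [s] between 0 and the length of the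
   i-th side; the corresponding point of the comparison triangle is [c' i s].
   The two points compared may lie on the same side. *)
Definition CAT0_space (R : realType) (X : metricType R) : Prop :=
  [/\ [set: X] !=set0,
      geodesic_space X &
      forall (v : 'I_3 -> X) (c : 'I_3 -> R -> X)
             (v' : 'I_3 -> 'rV[R]_2) (c' : 'I_3 -> R -> 'rV[R]_2),
        geodesic_triangle mdist v c ->
        comparison_triangle v v' c' ->
        forall (i j : 'I_3) (s t : R),
          0 <= s <= mdist (v i) (v (ordS i)) ->
          0 <= t <= mdist (v j) (v (ordS j)) ->
          mdist (c i s) (c j t) <= euclidean_dist (c' i s) (c' j t)].

Definition isometric_action (R : realType) (G : groupType) (X : metricType R)
    (act : G -> X -> X) : Prop :=
  [/\ forall x, act 1%g x = x,
      forall g h x, act (g * h)%g x = act g (act h x) &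
      forall g x y, mdist (act g x) (act g y) = mdist x y].

Definition proper_action (R : realType) (G : groupType) (X : metricType R)
    (act : G -> X -> X) : Prop :=
  forall x : X, exists2 r : R, 0 < r &
    finite_set [set g | (act g @` ball x r) `&` ball x r !=set0].

Definition cocompact_action (R : realType) (G : groupType) (X : metricType R)
    (act : G -> X -> X) : Prop :=
  exists2 K : set X, compact K & \bigcup_g (act g @` K) = [set: X].

Definition geometric_action (R : realType) (G : groupType) (X : metricType R)
    (act : G -> X -> X) : Prop :=
  [/\ isometric_action act, proper_action act & cocompact_action act].

Definition CAT0_group (R : realType) (G : groupType) : Prop :=
  exists (X : metricType R) (act : G -> X -> X),
    CAT0_space X /\ geometric_action act.

(* Main.v *)
Require Import Defs.
From HB Require Import structures.
From mathcomp Require Import all_boot all_order all_algebra.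
From mathcomp Require Import all_classical all_reals all_analysis.
From mathcomp Require Import ring lra.

(** The product of two CAT(0) spaces with the l2 metric is CAT(0), and the
    product action on it is geometric; this is the direct implication.

    Conversely, let [G = G1 * G2] act geometrically on a CAT(0) space [X].
    Two constructions turn [X] into a space on which [G1] acts geometrically.

    First, by the Milnor-Schwarz argument [G] is finitely generated, hence so is
    [G2]; let [L] be the list of its generators, seen in [G].  The centralizer of
    [L] is [H = G1 * Z(G2)].  It preserves the set of the points that each [s] in
    [L] displaces by at most a constant [c s]; this set is convex because the
    metric is convex, and [H] acts cocompactly on it: when a point is moved into
    a compact fundamental set, the elements of [L] are replaced by conjugates of
    bounded displacement, of which there are finitely many, and two elements that
    conjugate [L] in the same way differ by an element of [H]
    ([centralizer_cocompact]).  So [H] acts geometrically on a CAT(0) space, and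
    the same reasoning shows that [H], hence [Z(G2)], is finitely generated.

    Second, the generators of the central subgroup [N = 1 * Z(G2)] of [H] are
    made to act trivially, one after the other, keeping a cocompact action of [H]
    that is proper modulo [N].  For a generator [z], restrict the action to the
    convex set where the displacement of [z] takes its minimum [l].  If [l = 0],
    then [z] is trivial there.  Otherwise every point lies on an axis of [z], and
    the translations along the axes form a flow by isometries that commutes
    with [H] ([flow_isometry], [flow_comm]).  The Busemann function of a flow
    line is affine, decreases at unit speed along the flow, and changes by an
    additive constant under each element of [H] ([busemann_affine],
    [busemann_flow], [busemann_cocycle]).  Its zero set is therefore convex, and
    an element of [H] acts on it as on [X], followed by the flow back to the zero
    set; for [z] this is the identity ([level_set_model]).  The zero set plays
    the part of the factor [Y] in the decomposition of the minimal set of [z] as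
    a product of [Y] and a line.

    Once [N] acts trivially, the action of [H] amounts to a geometric action of
    [H / N], which is [G1] ([CAT0_group_factor]).

    The CAT(0) condition is used in the form of the CN inequality, which is an
    inequality between squared distances ([CAT0_spaceP]). *)

Set Implicit Arguments.
Unset Strict Implicit.
Unset Printing Implicit Defensive.

Import Order.TTheory GRing.Theory Num.Theory.
Import numFieldNormedType.Exports.

Local Open Scope classical_set_scope.
Local Open Scope ring_scope.

(** * Euclidean comparison triangles *)

Section EuclideanPlane.
Context {R : realType}.
Implicit Types p q x y : 'rV[R]_2.

Lemma euclidean_dist_ge0 p q : 0 <= euclidean_dist p q.
Proof. exact: sqrtr_ge0. Qed.

Lemma sqr_euclidean_dist p q :
  euclidean_dist p q ^+ 2
  = (p ord0 ord0 - q ord0 ord0) ^+ 2 + (p ord0 ord_max - q ord0 ord_max) ^+ 2.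
Proof.
rewrite sqr_sqrtr; last by apply: sumr_ge0 => i _; exact: sqr_ge0.
rewrite big_ord_recl big_ord1.
by congr (_ + (p _ _ - q _ _) ^+ 2); exact: val_inj.
Qed.

Lemma euclidean_dist_eq0 p q : euclidean_dist p q = 0 -> p = q.
Proof.
move=> pq0; have := sqr_euclidean_dist p q; rewrite pq0 expr0n /= => /esym/eqP.
rewrite paddr_eq0 ?sqr_ge0// !sqrf_eq0 !subr_eq0 => /andP[/eqP e0 /eqP e1].
apply/rowP => i; case: (unliftP ord0 i) => [j|] ->; last exact: e0.
by rewrite (ord1 j); have -> : lift ord0 ord0 = ord_max :> 'I_2 by exact: val_inj.
Qed.

Definition segment_point p q (t : R) := p + t *: (q - p).

Lemma sqr_dist_segment_point (p x y : 'rV[R]_2) t :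
  euclidean_dist p (segment_point x y t) ^+ 2
  = (1 - t) * euclidean_dist p x ^+ 2 + t * euclidean_dist p y ^+ 2
    - t * (1 - t) * euclidean_dist x y ^+ 2.
Proof. by rewrite !sqr_euclidean_dist !mxE; ring. Qed.

Lemma ge0_sqr_inj (a b : R) : 0 <= a -> 0 <= b -> a ^+ 2 = b ^+ 2 -> a = b.
Proof. by move=> a0 b0 /eqP; rewrite eqrXn2// => /eqP. Qed.

Lemma segment_is_geodesic p q : is_geodesic (@euclidean_dist R) p q
  (fun s => segment_point p q (s / euclidean_dist p q)).
Proof.
have [pq0|pq0] := eqVneq (euclidean_dist p q) 0.
  have E := euclidean_dist_eq0 pq0; split.
  - by rewrite /segment_point mul0r scale0r addr0.
  - by rewrite /segment_point E subrr scaler0 addr0.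
  - rewrite pq0 => s t /andP[s0 s1] /andP[t0 t1].
    have -> : s = 0 by lra.
    have -> : t = 0 by lra.
    by rewrite subrr normr0 /segment_point !mul0r scale0r addr0 E -{1}E pq0.
split.
- by rewrite /segment_point mul0r scale0r addr0.
- by rewrite /segment_point divff// scale1r addrC subrK.
- move=> s t _ _; apply: ge0_sqr_inj; rewrite ?euclidean_dist_ge0//.
  rewrite real_normK ?num_real// sqr_euclidean_dist !mxE.
  have := sqr_euclidean_dist p q => H.
  set L := euclidean_dist p q in H pq0 *.
  transitivity ((s / L - t / L) ^+ 2 * L ^+ 2); last by field.
  by rewrite H; ring.
Qed.

Lemma euclidean_distC p q : euclidean_dist p q = euclidean_dist q p.
Proof.
by apply: ge0_sqr_inj; rewrite ?euclidean_dist_ge0// !sqr_euclidean_dist; ring.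
Qed.

(** Equality in the CN inequality: a plane geodesic is the affine segment,
    because its point and the affine point at the same parameter are at
    distance zero by the identity for the affine point. *)
Lemma sqr_dist_plane_geodesic p x y c t : 0 <= t <= 1 ->
  is_geodesic (@euclidean_dist R) x y c ->
  euclidean_dist p (c (t * euclidean_dist x y)) ^+ 2
  = (1 - t) * euclidean_dist p x ^+ 2 + t * euclidean_dist p y ^+ 2
    - t * (1 - t) * euclidean_dist x y ^+ 2.
Proof.
move=> /andP[t0 t1] [c0 c1 cst].
have L0 := euclidean_dist_ge0 x y.
rewrite -sqr_dist_segment_point; congr (euclidean_dist p _ ^+ 2).
apply: euclidean_dist_eq0; apply/eqP; rewrite -sqrf_eq0 sqr_dist_segment_point.
set L := euclidean_dist x y in c1 cst L0 *.
have tL : 0 <= t * L <= L by apply/andP; split; nra.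
rewrite -{1}c0 -{1}c1 !cst// ?lexx ?L0//.
by rewrite !real_normK ?num_real//; apply/eqP; ring.
Qed.

(** The third vertex is placed by the law of cosines; the triangle inequalities
    bound its abscissa [u] by [c] in absolute value. *)
Lemma euclidean_triangle (a b c : R) : 0 < a -> 0 <= b -> 0 <= c ->
  a <= b + c -> b <= c + a -> c <= a + b ->
  exists x y z : 'rV[R]_2, [/\ euclidean_dist x y = a,
    euclidean_dist y z = b & euclidean_dist z x = c].
Proof.
move=> a0 b0 c0 abc bca cab.
pose pt (u w : R) : 'rV[R]_2 := \row_i (if i == ord0 then u else w).
pose u := (a ^+ 2 + c ^+ 2 - b ^+ 2) / (2 * a).
have ua : u * (2 * a) = a ^+ 2 + c ^+ 2 - b ^+ 2.
  by rewrite /u divfK// mulf_neq0// gt_eqF.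
have w0 : 0 <= c ^+ 2 - u ^+ 2.
  have h1 : u <= c.
    rewrite /u ler_pdivrMr ?mulr_gt0//; nra.
  have h2 : - c <= u.
    rewrite /u ler_pdivlMr ?mulr_gt0//; nra.
  nra.
pose w := Num.sqrt (c ^+ 2 - u ^+ 2).
have w2 : w ^+ 2 = c ^+ 2 - u ^+ 2 by rewrite sqr_sqrtr.
exists (pt 0 0), (pt a 0), (pt u w).
split; apply: ge0_sqr_inj; rewrite ?euclidean_dist_ge0// ?(ltW a0)//
  sqr_euclidean_dist !mxE /=; nra.
Qed.

End EuclideanPlane.

(** * The CN inequality *)

Section CNInequality.
Context {R : realType} (X : metricType R).
Implicit Types x y p q m : X.

(** For [t] equal to one half this is the semi-parallelogram law of Bruhat and
    Tits. *)
Definition cn_point x y (t : R) m := forall p,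
  mdist p m ^+ 2 <= (1 - t) * mdist p x ^+ 2 + t * mdist p y ^+ 2
                    - t * (1 - t) * mdist x y ^+ 2.

Definition cn_space := forall x y (t : R), 0 <= t <= 1 ->
  exists m, cn_point x y t m.

Lemma ler_of_sqr (a b : R) : 0 <= b -> a ^+ 2 <= b ^+ 2 -> a <= b.
Proof.
move=> b0 ab; have [//|ba] := leP a b.
by have := ltrXn2r 2 b0 ba; rewrite /= ltNge ab.
Qed.

Lemma cn_point_distl x y t m : 0 <= t <= 1 -> cn_point x y t m ->
  mdist x m <= t * mdist x y.
Proof.
move=> /andP[t0 t1] /(_ x); rewrite mdistxx => H.
have := mdist_ge0 x y => d0.
by apply: ler_of_sqr; [exact: mulr_ge0 | nra].
Qed.

Lemma cn_point_distr x y t m : 0 <= t <= 1 -> cn_point x y t m ->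
  mdist m y <= (1 - t) * mdist x y.
Proof.
move=> /andP[t0 t1] /(_ y); rewrite mdistxx (metric_sym y x) (metric_sym y m) => H.
have := mdist_ge0 x y => d0.
by apply: ler_of_sqr; [apply: mulr_ge0; lra | nra].
Qed.

(** The CN inequality for [q] itself bounds the squared distance of [q] and [m]
    by zero. *)
Lemma cn_point_uniq x y t m q : 0 <= t <= 1 -> cn_point x y t m ->
  mdist x q <= t * mdist x y -> mdist q y <= (1 - t) * mdist x y -> q = m.
Proof.
move=> /andP[t0 t1] /(_ q) H xq qy; apply: mdist_positivity.
apply/eqP; rewrite -sqrf_eq0 eq_le sqr_ge0 andbT (le_trans H)//.
rewrite (metric_sym q x).
have d0 := mdist_ge0 x y; have d1 := mdist_ge0 x q; have d2 := mdist_ge0 q y.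
have e1 : mdist x q ^+ 2 <= (t * mdist x y) ^+ 2.
  by rewrite lerXn2r// nnegrE// mulr_ge0.
have e2 : mdist q y ^+ 2 <= ((1 - t) * mdist x y) ^+ 2.
  by rewrite lerXn2r// nnegrE// mulr_ge0// subr_ge0.
have f1 : (1 - t) * mdist x q ^+ 2 <= (1 - t) * (t * mdist x y) ^+ 2.
  by rewrite ler_wpM2l// subr_ge0.
have f2 : t * mdist q y ^+ 2 <= t * ((1 - t) * mdist x y) ^+ 2.
  by rewrite ler_wpM2l.
apply: le_trans (_ : (1 - t) * (t * mdist x y) ^+ 2
  + t * ((1 - t) * mdist x y) ^+ 2 - t * (1 - t) * mdist x y ^+ 2 <= 0).
  by rewrite lerD2r lerD.
by rewrite le_eqVlt; apply/orP; left; apply/eqP; ring.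
Qed.

(** A degenerate side has [L = 0] and [s = 0], and then [t = 0] will do. *)
Lemma unit_parameter (s L : R) : 0 <= s <= L -> exists2 t, 0 <= t <= 1 & s = t * L.
Proof.
move=> /andP[s0 sL]; have [L0|L0] := eqVneq L 0.
  by exists 0; rewrite ?lexx ?ler01//; lra.
have L1 : 0 < L by rewrite lt_neqAle eq_sym L0 (le_trans s0).
by exists (s / L); rewrite ?divfK// divr_ge0 ?(ltW L1)//= ler_pdivrMr ?mul1r.
Qed.

(** Geodesics are unique, so the point of [c] is the one that [cn_space]
    provides. *)
Lemma geodesic_cn_point x y c t : cn_space -> 0 <= t <= 1 ->
  is_geodesic mdist x y c -> cn_point x y t (c (t * mdist x y)).
Proof.
move=> cnX t01 [c0 c1 cst]; have [m mP] := cnX x y t t01.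
have d0 := mdist_ge0 x y; have /andP[t0 t1] := t01.
have tL : 0 <= t * mdist x y <= mdist x y by apply/andP; split; nra.
rewrite (@cn_point_uniq x y t m (c (t * mdist x y)))//.
  by rewrite -{1}c0 cst ?lexx ?d0// ler_norml; apply/andP; split; nra.
by rewrite -{2}c1 cst ?lexx ?d0// ler_norml; apply/andP; split; nra.
Qed.

(** The CN points of a pair, one for each parameter, form a geodesic: the CN
    inequality bounds their distances from above, and the triangle inequality
    through the first end point bounds them from below. *)
Lemma cn_geodesic_space : cn_space -> geodesic_space X.
Proof.
move=> cnX x y.
have [f fP] : {f : R -> X & forall t, 0 <= t <= 1 -> cn_point x y t (f t)}.
  apply: (@choice R X (fun t m => 0 <= t <= 1 -> cn_point x y t m)) => t.
  have [t01|nt] := pselect (0 <= t <= 1); last by exists x.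
  by have [m mP] := cnX x y t t01; exists m.
have d0 := mdist_ge0 x y.
have distf t : 0 <= t <= 1 -> mdist x (f t) = t * mdist x y.
  move=> t01; apply/eqP; rewrite eq_le (cn_point_distl t01 (fP _ t01))/=.
  have := cn_point_distr t01 (fP _ t01); have := metric_triangle x (f t) y.
  lra.
have distf' t : 0 <= t <= 1 -> mdist (f t) y = (1 - t) * mdist x y.
  move=> t01; apply/eqP; rewrite eq_le (cn_point_distr t01 (fP _ t01))/=.
  have := cn_point_distl t01 (fP _ t01); have := metric_triangle x (f t) y.
  lra.
have distff s t : 0 <= s <= 1 -> 0 <= t <= 1 ->
    mdist (f s) (f t) = `|s - t| * mdist x y.
  move=> s01 t01; apply/eqP; rewrite eq_le; apply/andP; split.
    apply: ler_of_sqr; first by rewrite mulr_ge0.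
    rewrite exprMn real_normK ?num_real//.
    apply: (le_trans (fP _ t01 _)).
    rewrite (metric_sym _ x) distf// distf'//.
    by rewrite le_eqVlt; apply/orP; left; apply/eqP; ring.
  have := metric_triangle x (f s) (f t); have := metric_triangle x (f t) (f s).
  rewrite !distf// (metric_sym (f t) (f s)) => h1 h2.
  rewrite -[X in _ * X]ger0_norm// -normrM ler_norml; apply/andP; split; lra.
have [L0|L0] := eqVneq (mdist x y) 0.
  exists (fun=> x); split => //; first exact: mdist_positivity.
  rewrite L0 => s t /andP[s0 s1] /andP[t0 t1].
  have -> : s = 0 by lra.
  have -> : t = 0 by lra.
  by rewrite subrr normr0 mdistxx.
have L1 : 0 < mdist x y by rewrite lt_neqAle eq_sym L0.
have range01 s : 0 <= s <= mdist x y -> 0 <= s / mdist x y <= 1.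
  by move=> /andP[s0 s1]; rewrite divr_ge0//= ler_pdivrMr// mul1r.
exists (fun s => f (s / mdist x y)); split.
- apply/esym/mdist_positivity; rewrite mul0r distf ?mul0r//.
  by rewrite lexx ler01.
- by apply/mdist_positivity; rewrite divff// distf' ?subrr ?mul0r// lexx ler01.
- move=> s t s01 t01; rewrite distff ?range01// -mulrBl normrM.
  by rewrite [X in _ * X * _]ger0_norm ?invr_ge0// mulfVK.
Qed.

End CNInequality.

Section CNCharacterization.
Context {R : realType} (X : metricType R).
Implicit Types x y p q m : X.

(** The CN inequality is the comparison of a vertex with a point of the opposite
    side. *)
Lemma CAT0_space_cn : CAT0_space X -> cn_space X.
Proof.
case=> _ geoX catX x y t t01; have /andP[t0 t1] := t01.
have [xy0|xy0] := eqVneq (mdist x y) 0.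
  exists x => p; rewrite xy0 -(mdist_positivity _ _ xy0).
  by rewrite le_eqVlt; apply/orP; left; apply/eqP; ring.
have xy1 : 0 < mdist x y by rewrite lt_neqAle eq_sym xy0 mdist_ge0.
have [c0 c0P] := geoX x y.
exists (c0 (t * mdist x y)) => p.
have [c1 c1P] := geoX y p; have [c2 c2P] := geoX p x.
have tri1 := metric_triangle x p y; have tri2 := metric_triangle y x p.
have tri3 := metric_triangle p y x.
have [x' [y' [p' [xy' yp' px']]]] : exists x' y' p' : 'rV[R]_2,
    [/\ euclidean_dist x' y' = mdist x y, euclidean_dist y' p' = mdist y p &
    euclidean_dist p' x' = mdist p x].
  apply: euclidean_triangle; rewrite ?mdist_ge0//;
  move: tri1 tri2 tri3; rewrite !(metric_sym p) (metric_sym y x); lra.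
(* The vertices are [x], [y], [p] in this order, so that side [0] is [c0] and
   [p] is the initial point of side [2]. *)
pose sel (T : Type) (a b c : T) (i : 'I_3) := nth c [:: a; b] i.
pose line u v s := segment_point u v (s / @euclidean_dist R u v).
have tri : geodesic_triangle mdist (sel _ x y p) (sel _ c0 c1 c2).
  by case=> [[|[|[|i]]] Hi].
have cmp : comparison_triangle (sel _ x y p) (sel _ x' y' p')
    (sel _ (line x' y') (line y' p') (line p' x')).
  split; last by case=> [[|[|[|i]]] Hi].
  by case=> [[|[|[|i]]] Hi] //; apply: segment_is_geodesic.
have tL : 0 <= t * mdist x y <= mdist x y by apply/andP; split; nra.
have := catX _ _ _ _ tri cmp ord0 ord_max (t * mdist x y) 0 tL
  ltac:(by rewrite lexx mdist_ge0).
rewrite /sel /= => H.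
have [E _ _] := c2P; rewrite E in H.
have H2 : mdist (c0 (t * mdist x y)) p ^+ 2
    <= euclidean_dist (line x' y' (t * mdist x y)) (line p' x' 0) ^+ 2.
  by rewrite lerXn2r ?nnegrE ?mdist_ge0 ?euclidean_dist_ge0.
rewrite (metric_sym p); apply: (le_trans H2).
have [E' _ _] := @segment_is_geodesic R p' x'; rewrite /line E'.
rewrite euclidean_distC xy' mulfK// sqr_dist_segment_point px' xy'.
by rewrite (euclidean_distC p') yp' (metric_sym p y).
Qed.

(** Two points on distinct sides of a triangle lie on sides with a common
    vertex.  Applying the CN inequality first to the side of one point and then
    to the side of the other bounds their distance by an expression that in the
    plane is an equality. *)
Lemma cn_space_CAT0 : [set: X] !=set0 -> cn_space X -> CAT0_space X.
Proof.
move=> X0 cnX; split => //; first exact: cn_geodesic_space.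
move=> v c v' c' tri [tri' len].
have adjacent (i : 'I_3) s t : 0 <= s <= mdist (v i) (v (ordS i)) ->
    0 <= t <= mdist (v (ordS i)) (v (ordS (ordS i))) ->
    mdist (c i s) (c (ordS i) t) <= euclidean_dist (c' i s) (c' (ordS i) t).
  move=> /unit_parameter[a a01 ->] /unit_parameter[b b01 ->].
  have /andP[a0 a1] := a01; have /andP[b0 b1] := b01.
  set j := ordS i; have k_i : ordS (ordS j) = i.
    by rewrite /j; apply: val_inj; case: (i) => [[|[|[|n]]] Hi].
  set k := ordS j in k_i *.
  have ci := geodesic_cn_point cnX a01 (tri i).
  have cj := geodesic_cn_point cnX b01 (tri j).
  apply: ler_of_sqr; first exact: euclidean_dist_ge0.
  apply: le_trans (cj _) _.
  rewrite -!len.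
  rewrite sqr_dist_plane_geodesic//.
  rewrite !(@euclidean_distC R (c' i _)) !sqr_dist_plane_geodesic//.
  have := ci (v k); have := ci (v j); rewrite -/j -/k.
  rewrite !(metric_sym _ (c i _)) -!len !mdistxx.
  have -> : mdist (v k) (v i) = euclidean_dist (v' k) (v' i).
    by rewrite -k_i len.
  rewrite (metric_sym (v k)) -len (@euclidean_distC R (v' k) (v' j)).
  rewrite (metric_sym (v j)) -len (@euclidean_distC R (v' j) (v' i)).
  have -> : euclidean_dist (v' j) (v' j) = 0 :> R.
    by apply/eqP; rewrite -sqrf_eq0 sqr_euclidean_dist !subrr expr0n addr0.
  set D1 := mdist _ (v j) ^+ 2; set D2 := mdist _ (v k) ^+ 2 => h1 h2.
  rewrite lerD2r; apply: lerD; apply: ler_wpM2l; rewrite ?subr_ge0//.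
move=> i j s t si tj.
have [ij|ij] := eqVneq i j.
  rewrite -ij in tj *; have [_ _ e] := tri i; rewrite e//.
  by have [_ _ e'] := tri' i; rewrite e' ?len.
have [Ej|nj] := eqVneq j (ordS i).
  by rewrite Ej in tj *; apply: adjacent.
have Ei : i = ordS j.
  move: ij nj; case: (i) (j) => [[|[|[|n]]] Hi] [[|[|[|m]]] Hj] //= _ _;
  exact: val_inj.
rewrite metric_sym euclidean_distC; rewrite Ei in si *; exact: adjacent.
Qed.

(** The CN inequality only mentions points, whereas triangle comparison
    quantifies over geodesics; this makes it immediate for convex subsets and for
    products. *)
Lemma CAT0_spaceP : CAT0_space X <-> [set: X] !=set0 /\ cn_space X.
Proof.
split=> [catX|[]]; last exact: cn_space_CAT0.
by split; [case: catX | exact: CAT0_space_cn].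
Qed.

End CNCharacterization.

Definition isometric (R : realType) (X : metricType R) (f : X -> X) :=
  forall x y, mdist (f x) (f y) = mdist x y.

Lemma half01 (R : realType) : 0 <= (2^-1 : R) <= 1.
Proof. by rewrite invr_ge0 ler0n/= invf_le1 ?ltr0n// ler1n. Qed.

(** * Convexity of the metric *)

Section Segments.
Context {R : realType} {X : metricType R}.
Implicit Types x y p q m : X.

Definition seg x y (t : R) := xget x (cn_point x y t).

Context (cnX : cn_space X).

Lemma segP x y t : 0 <= t <= 1 -> cn_point x y t (seg x y t).
Proof. by move=> t01; have [m mP] := cnX x y t01; exact: (xgetPex x (ex_intro _ m mP)). Qed.

Lemma seg_distl x y t : 0 <= t <= 1 -> mdist x (seg x y t) = t * mdist x y.
Proof.
move=> t01; apply/eqP; rewrite eq_le (cn_point_distl t01 (segP x y t01))/=.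
have := cn_point_distr t01 (segP x y t01).
have := metric_triangle x (seg x y t) y; lra.
Qed.

Lemma seg_distr x y t : 0 <= t <= 1 -> mdist (seg x y t) y = (1 - t) * mdist x y.
Proof.
move=> t01; apply/eqP; rewrite eq_le (cn_point_distr t01 (segP x y t01))/=.
have := cn_point_distl t01 (segP x y t01).
have := metric_triangle x (seg x y t) y; lra.
Qed.

Lemma seg_uniq x y t q : 0 <= t <= 1 ->
  mdist x q <= t * mdist x y -> mdist q y <= (1 - t) * mdist x y ->
  q = seg x y t.
Proof. by move=> t01; apply: cn_point_uniq => //; exact: segP. Qed.

Lemma onem01 (t : R) : 0 <= t <= 1 -> 0 <= 1 - t <= 1.
Proof. by move=> t01; lra. Qed.

Lemma seg_sym x y t : 0 <= t <= 1 -> seg x y t = seg y x (1 - t).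
Proof.
move=> t01; have s01 := onem01 t01; apply: seg_uniq => //.
- by rewrite metric_sym seg_distr// (metric_sym y).
- by rewrite metric_sym seg_distl// (metric_sym y); lra.
Qed.

Lemma seg_isometry f x y t : isometric f -> 0 <= t <= 1 ->
  f (seg x y t) = seg (f x) (f y) t.
Proof.
by move=> If t01; apply: seg_uniq => //; rewrite !If ?seg_distl ?seg_distr.
Qed.

Lemma segxx x t : 0 <= t <= 1 -> seg x x t = x.
Proof.
by move=> t01; apply/esym/seg_uniq => //; rewrite mdistxx mulr0.
Qed.

(** Bounding the distance of two points at the same parameter by two
    applications of the CN inequality makes all the terms of the sides cancel
    except the one of the base. *)
Lemma seg_fork x y y' t : 0 <= t <= 1 ->
  mdist (seg x y t) (seg x y' t) <= t * mdist y y'.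
Proof.
move=> t01; have /andP[t0 t1] := t01.
apply: ler_of_sqr; first by rewrite mulr_ge0 ?mdist_ge0.
have h1 := segP x y' t01 (seg x y t).
have h2 := segP x y t01 y'.
rewrite (metric_sym _ x) seg_distl// in h1.
rewrite (metric_sym y' (seg _ _ _)) (metric_sym y' x) (metric_sym y' y) in h2.
have h3 : t * mdist (seg x y t) y' ^+ 2 <= t * ((1 - t) * mdist x y' ^+ 2
    + t * mdist y y' ^+ 2 - t * (1 - t) * mdist x y ^+ 2).
  exact: ler_wpM2l.
lra.
Qed.

(** Go from one segment to the other through the diagonal [seg x y'], which makes
    a fork with each of them. *)
Lemma seg_convex x x' y y' t : 0 <= t <= 1 ->
  mdist (seg x y t) (seg x' y' t) <= (1 - t) * mdist x x' + t * mdist y y'.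
Proof.
move=> t01; have h1 := seg_fork x y y' t01.
have h2 := seg_fork y' x x' (onem01 t01).
have := metric_triangle (seg x y t) (seg x y' t) (seg x' y' t).
rewrite (seg_sym x y') // (seg_sym x' y')// in h1 h2 *; lra.
Qed.

Lemma seg_dist_convex p x y t : 0 <= t <= 1 ->
  mdist p (seg x y t) <= (1 - t) * mdist p x + t * mdist p y.
Proof. by move=> t01; have := seg_convex p x p y t01; rewrite segxx. Qed.

(** Two applications of the semi-parallelogram law at the midpoint of a
    diagonal. *)
Lemma quadrilateral x y z w :
  mdist x z ^+ 2 + mdist y w ^+ 2
  <= mdist x y ^+ 2 + mdist y z ^+ 2 + mdist z w ^+ 2 + mdist w x ^+ 2.
Proof.
have h01 := @half01 R.
have hy := segP x z h01 y; have hw := segP x z h01 w.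
have := metric_triangle y (seg x z 2^-1) w.
move: hy hw; rewrite (metric_sym y x) (metric_sym w z).
rewrite (metric_sym (seg _ _ _) w).
have := mdist_ge0 y w; have := mdist_ge0 y (seg x z 2^-1).
have := mdist_ge0 w (seg x z 2^-1).
move: (mdist y (seg _ _ _)) (mdist w (seg _ _ _)) (mdist y w) => a b c.
move=> b0 a0 c0 ha hb cab.
have : c ^+ 2 <= (a + b) ^+ 2 by rewrite lerXn2r// nnegrE addr_ge0.
have := sqr_ge0 (a - b); nra.
Qed.

End Segments.

Lemma isometric_lipschitz (R : realType) (X : metricType R) (f : X -> X) :
  isometric f -> forall x y, mdist (f x) (f y) <= 1 * mdist x y.
Proof. by move=> If x y; rewrite If mul1r. Qed.

Lemma displacement_lipschitz (R : realType) (X : metricType R) (f : X -> X) :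
  isometric f -> forall x y, mdist x (f x) <= mdist y (f y) + 2 * mdist x y.
Proof.
move=> If x y; have := metric_triangle x y (f x).
have := metric_triangle y (f y) (f x); rewrite If (metric_sym y x); lra.
Qed.

Lemma displacement_convex (R : realType) (X : metricType R) (f : X -> X)
    (x y : X) (t c : R) : cn_space X -> isometric f -> 0 <= t <= 1 ->
  mdist x (f x) <= c -> mdist y (f y) <= c ->
  mdist (seg x y t) (f (seg x y t)) <= c.
Proof.
move=> cnX If t01 xc yc; rewrite (seg_isometry cnX x y If t01).
have := seg_convex cnX x (f x) y (f y) t01; have /andP[t0 t1] := t01.
have := ler_wpM2l t0 yc.
have : (1 - t) * mdist x (f x) <= (1 - t) * c.
  by apply: ler_wpM2l; rewrite ?subr_ge0.
lra.
Qed.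

(** * The flow along the axes of a translation *)

Section Flow.
Context {R : realType} {X : metricType R} (cnX : cn_space X).
Context (f g : X -> X) (l : R).
Context (If : isometric f) (fK : cancel f g) (gK : cancel g f).

Lemma iter_isometry h n : isometric h -> isometric (iter n h : X -> X).
Proof. by move=> Ih x y; elim: n => //= n <-; exact: Ih. Qed.

(** If [h] moved all points by [k] but [h (h x)] were closer to [x] than
    [k + k], then [h] would move the midpoint of [x] and [h x] by less than
    [k]. *)
Lemma displacement_double h (k : R) : isometric h ->
  (forall x : X, mdist x (h x) = k) -> forall x, mdist x (h (h x)) = k + k.
Proof.
move=> Ih hk x; apply/eqP; rewrite eq_le; apply/andP; split.
  by rewrite (le_trans (metric_triangle _ (h x) _))// !hk.
have h01 := @half01 R.
have := seg_fork cnX (h x) x (h (h x)) h01.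
rewrite (seg_sym cnX (h x) x) //; have -> : 1 - 2^-1 = 2^-1 :> R by lra.
rewrite -(seg_isometry cnX x (h x) Ih h01) hk; lra.
Qed.

Context (l0 : 0 < l) (fl : forall x, mdist x (f x) = l).

Lemma dist_iter_le n x : mdist x (iter n f x) <= n%:R * l.
Proof.
elim: n => [|n IHn]; first by rewrite mdistxx mul0r.
rewrite (le_trans (metric_triangle _ (iter n f x) _))//=.
by rewrite fl -natr1 mulrDl mul1r lerD2r.
Qed.

(** Doubling settles the powers of [f] whose exponent is a power of two; a defect
    at another exponent would persist at the next power of two. *)
Lemma dist_iter n x : mdist x (iter n f x) = n%:R * l.
Proof.
have pow k : forall y, mdist y (iter (2 ^ k) f y) = (2 ^ k)%N%:R * l.
  elim: k => [|k IHk] y; first by rewrite mul1r /= fl.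
  rewrite expnS mul2n -addnn iterD.
  rewrite (displacement_double (iter_isometry _ If) IHk).
  by rewrite natrD mulrDl.
apply/eqP; rewrite eq_le dist_iter_le/=.
have nk : (n <= 2 ^ n)%N by exact/ltnW/ltn_expl.
have := metric_triangle x (iter n f x) (iter (2 ^ n) f x).
rewrite pow -{2}(subnK nk) iterD => h.
have := dist_iter_le (2 ^ n - n) (iter n f x).
by rewrite natrB// mulrBl; lra.
Qed.

Lemma iter_can n : cancel (iter n g) (iter n f).
Proof. by elim: n => // n IHn x; rewrite iterSr /= gK IHn. Qed.

Lemma inv_isometry : isometric g.
Proof. by move=> x y; rewrite -{2}(gK x) -{2}(gK y) If. Qed.

Lemma dist_inv_iter n x : mdist (iter n g x) x = n%:R * l.
Proof.
by rewrite -{2}(iter_can n x) dist_iter.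
Qed.

Lemma dist_iter_inv_iter n x : mdist (iter n g x) (iter n f x) = n%:R * l + n%:R * l.
Proof.
by rewrite -{2}(iter_can n x) -iterD dist_iter natrD mulrDl.
Qed.

(** This says that [q] is at the signed distance [t] from [x] on the axis of [f]
    through [x]: the two bounds add up to the distance of [iter n g x] and
    [iter n f x], so they determine a point of the segment that joins these. *)
Definition flow_to (t : R) (x q : X) := exists n : nat,
  mdist (iter n g x) q <= n%:R * l + t /\ mdist q (iter n f x) <= n%:R * l - t.

Lemma flow_to_from t x q : flow_to t x q -> exists n : nat,
  forall m, (n <= m)%N ->
  mdist (iter m g x) q <= m%:R * l + t /\ mdist q (iter m f x) <= m%:R * l - t.
Proof.
case=> n [gn fn]; exists n => m nm; rewrite -(subnK nm) !iterD natrD mulrDl.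
set k := (m - n)%N; split.
  have := metric_triangle (iter k g (iter n g x)) (iter n g x) q.
  rewrite dist_inv_iter; lra.
have := metric_triangle q (iter n f x) (iter k f (iter n f x)).
rewrite dist_iter; lra.
Qed.

(** The parameter of the point at the signed distance [t] from the midpoint of a
    segment of length [2 * m * l]. *)
Definition axis_ratio (t : R) m : R := (m%:R * l + t) / (m%:R * l + m%:R * l).

Lemma axis_ratioE t m x :
  axis_ratio t m.+1 * mdist (iter m.+1 g x) (iter m.+1 f x) = m.+1%:R * l + t /\
  (1 - axis_ratio t m.+1) * mdist (iter m.+1 g x) (iter m.+1 f x)
    = m.+1%:R * l - t.
Proof.
have ml : 0 < m.+1%:R * l by rewrite mulr_gt0// ltr0n.
suff E : axis_ratio t m.+1 * mdist (iter m.+1 g x) (iter m.+1 f x)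
    = m.+1%:R * l + t by split=> //; rewrite mulrBl E dist_iter_inv_iter; lra.
by rewrite dist_iter_inv_iter /axis_ratio divfK// gt_eqF// addr_gt0.
Qed.

Lemma axis_ratio01 t m : `|t| <= m.+1%:R * l -> 0 <= axis_ratio t m.+1 <= 1.
Proof.
have ml : 0 < m.+1%:R * l by rewrite mulr_gt0// ltr0n.
rewrite ler_norml => /andP[t1 t2]; rewrite /axis_ratio.
by rewrite divr_ge0/= ?ler_pdivrMr; lra.
Qed.

Lemma flow_to_seg t x q : flow_to t x q -> exists n : nat,
  forall m, (n <= m)%N -> 0 <= axis_ratio t m.+1 <= 1 /\
    q = seg (iter m.+1 g x) (iter m.+1 f x) (axis_ratio t m.+1).
Proof.
move=> /flow_to_from[n nP]; exists n => m nm.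
have [q1 q2] := nP m.+1 (leqW nm).
have [E1 E2] := axis_ratioE t m x.
have a01 : 0 <= axis_ratio t m.+1 <= 1.
  apply: axis_ratio01; rewrite ler_norml.
  have := mdist_ge0 (iter m.+1 g x) q; have := mdist_ge0 q (iter m.+1 f x).
  by move=> h1 h2; apply/andP; split; lra.
by split=> //; apply: seg_uniq; rewrite ?E1 ?E2.
Qed.

Lemma flow_to_uniq t x q q' : flow_to t x q -> flow_to t x q' -> q = q'.
Proof.
move=> /flow_to_seg[n nP] /flow_to_seg[n' nP'].
by have [_ ->] := nP _ (leq_maxl n n'); have [_ ->] := nP' _ (leq_maxr n n').
Qed.

Lemma flow_to_exists t x : exists q, flow_to t x q.
Proof.
pose m := Num.bound (`|t| / l).
have tm : `|t| <= m.+1%:R * l.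
  rewrite -ler_pdivrMr// (le_trans (ltW (archi_boundP _)))//.
    by rewrite divr_ge0// ltW.
  by rewrite ler_nat.
exists (seg (iter m.+1 g x) (iter m.+1 f x) (axis_ratio t m.+1)), m.+1.
have [E1 E2] := axis_ratioE t m x; have a01 := axis_ratio01 tm.
by rewrite seg_distl// seg_distr// E1 E2.
Qed.

Definition flow t x := xget x (flow_to t x).

Lemma flowP t x : flow_to t x (flow t x).
Proof. by have [q qP] := flow_to_exists t x; exact: (xgetPex x (ex_intro _ q qP)). Qed.

Lemma flowE t x q : flow_to t x q -> flow t x = q.
Proof. by move=> qP; exact: flow_to_uniq (flowP t x) qP. Qed.

(** The bounds that define [flow_to] add up by the triangle inequality. *)
Lemma flowD s t x : flow s (flow t x) = flow (s + t) x.
Proof.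
apply/esym/flowE; have [n [gn fn]] := flowP t x.
set q := flow t x in gn fn *; have [m [gm fm]] := flowP s q.
exists (m + n)%N; rewrite !iterD natrD mulrDl; split.
  have := metric_triangle (iter m g (iter n g x)) (iter m g q) (flow s q).
  by rewrite (iter_isometry _ inv_isometry); lra.
have := metric_triangle (flow s q) (iter m f q) (iter m f (iter n f x)).
by rewrite (iter_isometry _ If); lra.
Qed.

Lemma flow0 x : flow 0 x = x.
Proof. by apply: flowE; exists 0%N; rewrite mdistxx mul0r addr0 subr0. Qed.

Lemma flow_f x : flow l x = f x.
Proof.
apply: flowE; exists 1%N; rewrite mdistxx !mul1r subrr; split => //.
rewrite (le_trans (metric_triangle _ x _))// fl -(fl (g x)) gK //=.
Qed.

Lemma flow_comm h t x : isometric h -> (forall y, h (f y) = f (h y)) ->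
  flow t (h x) = h (flow t x).
Proof.
move=> Ih hf; have hg y : h (g y) = g (h y) by rewrite -[in RHS](gK y) hf fK.
have hfn n y : iter n f (h y) = h (iter n f y) by elim: n => //= n ->.
have hgn n y : iter n g (h y) = h (iter n g y) by elim: n => //= n ->.
apply: flowE; have [n [gn fn]] := flowP t x; exists n.
by rewrite hfn hgn !Ih.
Qed.

(** By convexity of the metric, the distance of two points at the same time on
    two axes is at most that of the distant points [iter m g x] and [iter m g y],
    which is the distance of [x] and [y].  The flow for the opposite time gives
    the reverse inequality. *)
Lemma flow_isometry t : isometric (flow t).
Proof.
have le s x y : mdist (flow s x) (flow s y) <= mdist x y.
  have /flow_to_seg[n nP] := flowP s x; have /flow_to_seg[n' nP'] := flowP s y.
  have [a01 ->] := nP _ (leq_maxl n n'); have [_ ->] := nP' _ (leq_maxr n n').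
  apply: le_trans (seg_convex cnX _ _ _ _ a01) _.
  by rewrite !iter_isometry//; [lra | exact: inv_isometry].
move=> x y; apply/eqP; rewrite eq_le le/=.
by have := le (- t) (flow t x) (flow t y); rewrite !flowD addNr !flow0.
Qed.

Lemma dist_flow t x : mdist x (flow t x) = `|t|.
Proof.
wlog t0 : t x / 0 <= t.
  move=> H; have [t0|t0] := leP 0 t; first exact: H.
  rewrite -(flow_isometry (- t)) flowD addNr flow0 metric_sym H ?normrN//.
  by rewrite oppr_ge0 ltW.
have /flow_to_from[n nP] := flowP t x.
have [_ q2] := nP n.+1 (leqnSn n).
rewrite ger0_norm//.
pose m := n.+1; rewrite -/m in q2.
have ml : 0 < m%:R * l by rewrite mulr_gt0// ltr0n.
have tml : t <= m%:R * l.
  by have := mdist_ge0 (flow t x) (iter m f x); lra.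
pose a := t / (m%:R * l).
have a01 : 0 <= a <= 1.
  by rewrite /a divr_ge0 ?(ltW ml)//= ler_pdivrMr// mul1r.
have Ea : a * mdist x (iter m f x) = t by rewrite dist_iter /a divfK// gt_eqF.
have Ea' : (1 - a) * mdist x (iter m f x) = m%:R * l - t.
  by rewrite mulrBl mul1r Ea dist_iter.
have -> : flow t x = seg x (iter m f x) a.
  apply: flowE; exists m; rewrite seg_distr// Ea'; split => //.
  rewrite (le_trans (metric_triangle _ x _))// seg_distl// Ea.
  by rewrite dist_inv_iter.
by rewrite seg_distl.
Qed.

End Flow.

(** * Busemann functions of the flow lines *)

Section Busemann.
Context {R : realType} {X : metricType R} (cnX : cn_space X).
Context (T : R -> X -> X).
Context (TD : forall s t x, T s (T t x) = T (s + t) x).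
Context (T0 : forall x, T 0 x = x).
Context (IT : forall t, isometric (T t)).
Context (dT : forall t x, mdist x (T t x) = `|t|).

(** The Busemann function, at [x], of the flow line of [y], normalized to vanish
    at [y]. *)
Definition busemann x y : R := inf [set mdist x (T t y) - t | t in [set: R]].

Lemma busemann_bounded x y t : - mdist x y <= mdist x (T t y) - t.
Proof.
have := metric_triangle y x (T t y); rewrite dT (metric_sym y x).
have := ler_norm t; lra.
Qed.

Lemma busemann_has_inf x y :
  has_inf [set mdist x (T t y) - t | t in [set: R]].
Proof.
split; first by exists (mdist x (T 0 y) - 0), 0.
by exists (- mdist x y) => _ [t _ <-]; exact: busemann_bounded.
Qed.

Lemma busemann_le t x y : busemann x y <= mdist x (T t y) - t.
Proof. by apply: ge_inf; [case: (busemann_has_inf x y) | exists t]. Qed.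

Lemma le_busemann c x y : (forall t, c <= mdist x (T t y) - t) ->
  c <= busemann x y.
Proof.
move=> cP; apply: lb_le_inf; first by case: (busemann_has_inf x y).
by move=> _ [t _ <-].
Qed.

(** The infimum is a limit at infinity, because [mdist x (T t y) - t] is
    nonincreasing in [t]. *)
Lemma busemann_approx e x y : 0 < e -> exists t0, forall t, t0 <= t ->
  mdist x (T t y) - t < busemann x y + e.
Proof.
move=> e0; have [_ [t0 _ <-] h] := inf_adherent e0 (busemann_has_inf x y).
exists t0 => t t0t; apply: le_lt_trans h.
have := metric_triangle x (T t0 y) (T t y).
have -> : t = (t - t0) + t0 by lra.
rewrite -[T (_ + t0) y]TD dT ger0_norm; lra.
Qed.

Lemma busemann_flow s x y : busemann (T s x) y = busemann x y - s.
Proof.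
have le r z : busemann (T r z) y <= busemann z y - r.
  rewrite lerBrDr; apply: le_busemann => t.
  by have := busemann_le (r + t) (T r z) y; rewrite -TD IT; lra.
apply/eqP; rewrite eq_le le /=.
by have := le (- s) (T s x); rewrite TD addNr T0; lra.
Qed.

Lemma busemann_triangle x y w : busemann x w <= busemann x y + busemann y w.
Proof.
rewrite -lerBlDr; apply: le_busemann => s.
suff : busemann x w - (mdist x (T s y) - s) <= busemann y w by lra.
apply: le_busemann => t.
have := busemann_le (s + t) x w.
have := metric_triangle x (T s y) (T (s + t) w).
by rewrite -TD IT; lra.
Qed.

(** Flow lines are parallel: by the quadrilateral inequality, the diagonals of
    the quadrilateral [x], [T t x], [T t y], [y] have a sum
    of at most [2 * t + O(1 / t)]. *)
Lemma busemann_antisym x y : busemann x y = - busemann y x.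
Proof.
apply/eqP; rewrite -subr_eq0 opprK; apply/eqP/le_anti/andP; split; last first.
  apply: le_trans (busemann_triangle x y x).
  by apply: le_busemann => t; rewrite dT subr_ge0 ler_norm.
rewrite leNgt; apply/negP; set e := _ + _ => e0.
set D := mdist x y; have D0 : 0 <= D := mdist_ge0 _ _.
(* At this time the bound [2 * Num.sqrt (t ^+ 2 + D ^+ 2)] for the sum of the
   diagonals is smaller than [2 * t + e]. *)
pose t := D ^+ 2 / e.
have te : t * e = D ^+ 2 by rewrite /t divfK// gt_eqF.
have t0 : 0 <= t by rewrite /t divr_ge0 ?sqr_ge0// ltW.
have := quadrilateral cnX x y (T t y) (T t x).
rewrite (metric_sym (T t y)) IT (metric_sym (T t x)) !dT (ger0_norm t0) -/D.
have := busemann_le t x y; have := busemann_le t y x.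
move: (mdist_ge0 x (T t y)) (mdist_ge0 y (T t x)).
move: (mdist x (T t y)) (mdist y (T t x)) => p q p0 q0 hq hp.
have hpq : 2 * t + e <= p + q by rewrite /e; lra.
have : (2 * t + e) ^+ 2 <= (p + q) ^+ 2.
  by rewrite lerXn2r// nnegrE; lra.
have := sqr_ge0 (p - q); have : 0 < e ^+ 2 by rewrite exprn_gt0.
nra.
Qed.

Lemma busemann_cocycle x y w : busemann x w = busemann x y + busemann y w.
Proof.
apply/eqP; rewrite eq_le busemann_triangle/=.
by have := busemann_triangle x w y; rewrite (busemann_antisym w y); lra.
Qed.

Lemma busemann_lipschitz x y w : busemann x w <= mdist x y + busemann y w.
Proof.
by have := busemann_le 0 x y; rewrite T0 subr0 (busemann_cocycle x y w) lerD2r.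
Qed.

Lemma busemann_isometry h x y : isometric h ->
  (forall t z, T t (h z) = h (T t z)) ->
  busemann (h x) (h y) = busemann x y.
Proof.
move=> Ih Th; rewrite /busemann; congr inf.
by apply: eq_imagel => t _; rewrite Th Ih.
Qed.

(** Convexity of the metric makes both [busemann ^~ w] and [busemann w] convex;
    these are opposite functions. *)
Lemma busemann_affine x y w s : 0 <= s <= 1 ->
  busemann (seg x y s) w = (1 - s) * busemann x w + s * busemann y w.
Proof.
move=> s01; have /andP[s0 s1] := s01.
apply/eqP; rewrite eq_le; apply/andP; split.
  apply/ler_addgt0Pl => e e0.
  have [t1 h1] := busemann_approx x w e0; have [t2 h2] := busemann_approx y w e0.
  pose t := Num.max t1 t2.
  have {}h1 := h1 t ltac:(by rewrite le_max lexx).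
  have {}h2 := h2 t ltac:(by rewrite le_max lexx orbT).
  apply: le_trans (busemann_le t _ _) _.
  have := seg_dist_convex cnX (T t w) x y s01.
  rewrite !(metric_sym (T t w)); nra.
rewrite (busemann_antisym (seg x y s)) (busemann_antisym x w).
rewrite (busemann_antisym y w).
suff : busemann w (seg x y s) <= (1 - s) * busemann w x + s * busemann w y by lra.
apply/ler_addgt0Pl => e e0.
have [t1 h1] := busemann_approx w x e0; have [t2 h2] := busemann_approx w y e0.
pose t := Num.max t1 t2.
have {}h1 := h1 t ltac:(by rewrite le_max lexx).
have {}h2 := h2 t ltac:(by rewrite le_max lexx orbT).
apply: le_trans (busemann_le t _ _) _.
rewrite (seg_isometry cnX x y (IT t) s01).
have := seg_dist_convex cnX w (T t x) (T t y) s01.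
have := ler_wpM2l s0 (ltW h2).
have : (1 - s) * (mdist w (T t x) - t) <= (1 - s) * (busemann w x + e).
  by apply: ler_wpM2l; [rewrite subr_ge0 | exact: ltW].
lra.
Qed.

End Busemann.

(** * Subspaces, products and compact sets *)

Definition metric_sub (R : realType) (X : metricType R) (Y : set X) :=
  {x : X | x \in Y}.

Section MetricSub.
Context {R : realType} {X : metricType R} (Y : set X).

Let sub_dist (x y : metric_sub Y) : R := mdist (sval x) (sval y).

Let sub_distxx x : sub_dist x x = 0.
Proof. exact: mdistxx. Qed.

Let sub_dist_positivity x y : sub_dist x y = 0 -> x = y.
Proof. by move=> /mdist_positivity; exact: val_inj. Qed.

Let sub_dist_sym x y : sub_dist x y = sub_dist y x.
Proof. exact: metric_sym. Qed.

Let sub_dist_triangle y x z : sub_dist x z <= sub_dist x y + sub_dist y z.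
Proof. exact: metric_triangle. Qed.

HB.instance Definition _ := Choice.copy (metric_sub Y) {x : X | x \in Y}.
HB.instance Definition _ := isMetric.Build R (metric_sub Y)
  sub_distxx sub_dist_positivity sub_dist_sym sub_dist_triangle.

Lemma mdist_sub (x y : metric_sub Y) : mdist x y = mdist (sval x) (sval y).
Proof. by []. Qed.

End MetricSub.

(** The type is renamed because the product type already carries the topology of
    the sup metric. *)
Definition l2_prod (R : realType) (X1 X2 : metricType R) := (X1 * X2)%type.

Section L2Prod.
Context {R : realType} {X1 X2 : metricType R}.
Implicit Types x y z : l2_prod X1 X2.

Let l2_dist x y : R := Num.sqrt (mdist x.1 y.1 ^+ 2 + mdist x.2 y.2 ^+ 2).

Let sqr_l2_dist x y : l2_dist x y ^+ 2 = mdist x.1 y.1 ^+ 2 + mdist x.2 y.2 ^+ 2.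
Proof. by rewrite sqr_sqrtr// addr_ge0 ?sqr_ge0. Qed.

Let l2_distxx x : l2_dist x x = 0.
Proof. by rewrite /l2_dist !mdistxx expr0n addr0 sqrtr0. Qed.

Let l2_dist_positivity x y : l2_dist x y = 0 -> x = y.
Proof.
move=> xy0; have := sqr_l2_dist x y; rewrite xy0 expr0n /= => /esym/eqP.
rewrite paddr_eq0 ?sqr_ge0// !sqrf_eq0 => /andP[/eqP e1 /eqP e2].
by rewrite (surjective_pairing x) (surjective_pairing y)
  (mdist_positivity _ _ e1) (mdist_positivity _ _ e2).
Qed.

Let l2_dist_sym x y : l2_dist x y = l2_dist y x.
Proof. by rewrite /l2_dist (metric_sym x.1) (metric_sym x.2). Qed.

(** Minkowski's inequality in the plane, by Cauchy-Schwarz. *)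
Let l2_dist_triangle y x z : l2_dist x z <= l2_dist x y + l2_dist y z.
Proof.
apply: ler_of_sqr; first by rewrite addr_ge0 ?sqrtr_ge0.
have p0 : 0 <= l2_dist x y := sqrtr_ge0 _.
have q0 : 0 <= l2_dist y z := sqrtr_ge0 _.
rewrite sqrrD; have := sqr_l2_dist x y; have := sqr_l2_dist y z.
have := sqr_l2_dist x z; move: (l2_dist x z) p0 q0.
move: (l2_dist x y) (l2_dist y z) => p q r p0 q0.
have := metric_triangle x.1 y.1 z.1; have := metric_triangle x.2 y.2 z.2.
have := mdist_ge0 x.1 y.1; have := mdist_ge0 x.2 y.2.
have := mdist_ge0 y.1 z.1; have := mdist_ge0 y.2 z.2.
have := mdist_ge0 x.1 z.1; have := mdist_ge0 x.2 z.2.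
move: (mdist x.1 y.1) (mdist y.1 z.1) (mdist x.1 z.1) => a1 a2 a.
move: (mdist x.2 y.2) (mdist y.2 z.2) (mdist x.2 z.2) => b1 b2 b.
move=> b0 a0 b20 a20 b10 a10 hb ha -> q2 p2; rewrite q2 p2.
have cs : a1 * a2 + b1 * b2 <= p * q.
  apply: ler_of_sqr; first exact: mulr_ge0.
  rewrite [leRHS]exprMn p2 q2; have := sqr_ge0 (a1 * b2 - a2 * b1); nra.
have : a ^+ 2 <= (a1 + a2) ^+ 2 by rewrite lerXn2r// nnegrE; lra.
have : b ^+ 2 <= (b1 + b2) ^+ 2 by rewrite lerXn2r// nnegrE; lra.
nra.
Qed.

HB.instance Definition _ := Choice.copy (l2_prod X1 X2) (X1 * X2)%type.
HB.instance Definition _ := isMetric.Build R (l2_prod X1 X2)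
  l2_distxx l2_dist_positivity l2_dist_sym l2_dist_triangle.

Lemma sqr_mdist_l2 x y : mdist x y ^+ 2 = mdist x.1 y.1 ^+ 2 + mdist x.2 y.2 ^+ 2.
Proof. exact: sqr_l2_dist. Qed.

Lemma mdist_l2_fst x y : mdist x.1 y.1 <= mdist x y.
Proof.
by apply: ler_of_sqr; rewrite ?mdist_ge0// sqr_mdist_l2 lerDl sqr_ge0.
Qed.

Lemma mdist_l2_snd x y : mdist x.2 y.2 <= mdist x y.
Proof.
by apply: ler_of_sqr; rewrite ?mdist_ge0// sqr_mdist_l2 lerDr sqr_ge0.
Qed.

Lemma mdist_l2_le x y : mdist x y <= mdist x.1 y.1 + mdist x.2 y.2.
Proof.
have h1 := mdist_ge0 x.1 y.1; have h2 := mdist_ge0 x.2 y.2.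
apply: ler_of_sqr; rewrite ?addr_ge0// sqr_mdist_l2 sqrrD; nra.
Qed.

Lemma cn_space_l2 : cn_space X1 -> cn_space X2 -> cn_space (l2_prod X1 X2).
Proof.
move=> cn1 cn2 x y t t01.
have [m1 h1] := cn1 x.1 y.1 t t01; have [m2 h2] := cn2 x.2 y.2 t t01.
exists ((m1, m2) : l2_prod X1 X2) => p; rewrite !sqr_mdist_l2 /=.
have := h1 p.1; have := h2 p.2; lra.
Qed.

End L2Prod.

Lemma ball_mdist (R : realType) (X : metricType R) (x : X) (r : R) (y : X) :
  ball x r y = (mdist x y < r) :> Prop.
Proof. by rewrite ballEmdist. Qed.

Section CompactMetric.
Context {R : realType} {X : metricType R}.
Implicit Types (K A B : set X) (x y : X).

(** The sets whose complement in [K] has the property [P] form a filter that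
    contains [K].  If [P K] failed, this filter would be proper, and it cannot
    have a cluster point in [K] because [P] holds locally. *)
Lemma compact_ind K (P : set X -> Prop) : compact K ->
  P set0 -> (forall A B, P A -> P B -> P (A `|` B)) ->
  (forall A B, A `<=` B -> P B -> P A) ->
  (forall x, K x -> exists2 r : R, 0 < r & P (ball x r)) -> P K.
Proof.
move=> cK P0 PU Psub Ploc; apply: contrapT => nPK.
pose F : set_system X := [set U | P (K `\` U)].
have PF : ProperFilter F.
  apply: Build_ProperFilter; first by rewrite /F /= setD0.
  split; first by rewrite /F /= setDT.
  - by move=> U V; rewrite /F /= setDIr => PK1 PK2; exact: PU.
  - by move=> U V UV; apply: Psub => z [Kz nVz]; split=> // /UV.
have FK : F K by rewrite /F /= setDv.
have [x [Kx clx]] := cK F PF FK.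
have [r r0 Pr] := Ploc x Kx.
have Fr : F (~` ball x r).
  by apply: Psub Pr => z [_ /contrapT].
have nr : nbhs x (ball x r) by exact: nbhsx_ballx.
by have [z []] := clx _ _ Fr nr.
Qed.

Lemma compact_dist_bounded K x : compact K ->
  exists D : R, forall y, K y -> mdist x y <= D.
Proof.
move=> cK; apply: (compact_ind cK (P := fun A =>
  exists D : R, forall y, A y -> mdist x y <= D)).
- by exists 0.
- move=> A B [D hD] [D' hD']; exists (Num.max D D') => y [/hD|/hD'] h;
  by rewrite le_max h ?orbT.
- by move=> A B AB [D hD]; exists D => y /AB/hD.
- move=> y _; exists 1 => //; exists (mdist x y + 1) => z; rewrite ball_mdist => yz.
  have := metric_triangle x y z; lra.
Qed.

Lemma lipschitz_continuous {Y : metricType R} (f : X -> Y) (c : R) : 0 < c ->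
  (forall x y, mdist (f x) (f y) <= c * mdist x y) -> continuous f.
Proof.
move=> c0 fc x; apply/cvg_ballP => e e0.
have ec : 0 < e / c by rewrite divr_gt0.
apply: filterS (nbhsx_ballx x _ ec) => y; rewrite !ball_mdist => xy.
by rewrite (le_lt_trans (fc x y))// mulrC -ltr_pdivlMr.
Qed.

Lemma lipschitz_fun_continuous (f : X -> R) (c : R) : 0 < c ->
  (forall x y, f x <= f y + c * mdist x y) -> continuous f.
Proof.
move=> c0 fc x; apply/cvgrPdist_lt => e e0.
have ec : 0 < e / c by rewrite divr_gt0.
apply: filterS (nbhsx_ballx x _ ec) => y; rewrite !ball_mdist => xy.
have := fc x y; have := fc y x; rewrite (metric_sym y x).
have : c * mdist x y < e by rewrite mulrC -ltr_pdivlMr.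
by move=> *; rewrite ltr_norml; apply/andP; split; lra.
Qed.

Lemma compact_lipschitz_min K (c : R) (f : X -> R) : compact K -> K !=set0 ->
  0 < c -> (forall x y, f x <= f y + c * mdist x y) ->
  exists2 x, K x & forall y, K y -> f x <= f y.
Proof.
move=> cK K0 c0 fc.
have cf : {within K, continuous f}.
  exact/continuous_subspaceT/(lipschitz_fun_continuous c0 fc).
have [x + xP] := compact_EVT_min K0 cK cf.
by rewrite inE => Kx; exists x => // y Ky; apply: xP; rewrite inE.
Qed.

Lemma closed_lipschitz_le (c : R) (f : X -> R) a : 0 < c ->
  (forall x y, f x <= f y + c * mdist x y) -> closed [set x | f x <= a].
Proof.
move=> c0 fc; have /continuous_closedP h := lipschitz_fun_continuous c0 fc.
exact: (h [set r | r <= a] (@closed_le _ a)).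
Qed.

Lemma compact_lipschitz_image {Y : metricType R} (f : X -> Y) (c : R) K :
  0 < c -> (forall x y, mdist (f x) (f y) <= c * mdist x y) -> compact K ->
  compact (f @` K).
Proof.
move=> c0 fc; apply: continuous_compact.
exact/continuous_subspaceT/(lipschitz_continuous c0 fc).
Qed.

Lemma compact_isometric_preimage {Y : metricType R} (i : Y -> X) K :
  (forall y y' : Y, mdist (i y) (i y') = mdist y y') -> K `<=` range i ->
  compact K -> compact (i @^-1` K).
Proof.
move=> Ii Ki cK F PF FK; have [x [Kx clx]] := cK (i @ F) (fmap_proper_filter i PF) FK.
have [y _ yx] := Ki x Kx; exists y; split; first by rewrite /= yx.
move=> A B FA; rewrite -nbhs_ballE => -[r /= r0 rB].
have iA : F (i @^-1` (i @` A)) by apply: filterS FA; exact: preimage_image.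
have [_ [[z Az <-]]] := clx (i @` A) (ball x r) iA (nbhsx_ballx x _ r0).
 rewrite ball_mdist -yx Ii => yz; exists z; split => //.
by apply: rB; rewrite ball_mdist.
Qed.

End CompactMetric.

Lemma compact_l2_prod (R : realType) (X1 X2 : metricType R) (K1 : set X1)
  (K2 : set X2) : compact K1 -> compact K2 ->
  compact ([set x | K1 x.1 /\ K2 x.2] : set (l2_prod X1 X2)).
Proof.
move=> cK1 cK2; pose i (x : X1 * X2) : l2_prod X1 X2 := x.
have ci : continuous i.
  move=> x; apply/cvg_ballP => e e0.
  have e2 : 0 < e / 2 by rewrite divr_gt0.
  exists (ball x.1 (e / 2), ball x.2 (e / 2)).
    by split; exact: nbhsx_ballx.
  move=> y [/=]; rewrite !ball_mdist => h1 h2.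
  by rewrite (le_lt_trans (mdist_l2_le _ _))//= (splitr e) ltrD.
have -> : [set x | K1 x.1 /\ K2 x.2] = i @` (K1 `*` K2).
  by apply/seteqP; split=> [x h|_ [x h <-]] //; exists x.
by apply: continuous_compact; [exact/continuous_subspaceT | exact: compact_setX].
Qed.

(** * Actions modulo a subgroup *)

Definition is_subgroup (G : groupType) (H : set G) :=
  [/\ H 1%g, forall g h, H g -> H h -> H (g * h)%g &
      forall g, H g -> H (g^-1)%g].

Lemma subgroup_expg (G : groupType) (N : set G) z n :
  is_subgroup N -> N z -> N (z ^+ n)%g.
Proof.
move=> [N1 NM _] Nz; elim: n => [|n IHn]; first by rewrite expg0.
by rewrite expgS; exact: NM.
Qed.

Section Actions.
Context {R : realType} {G : groupType}.
Implicit Types H N : set G.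

Definition acts_isometrically H (X : metricType R) (act : G -> X -> X) :=
  [/\ forall x, act 1%g x = x,
      forall g h, H g -> H h -> forall x, act (g * h)%g x = act g (act h x) &
      forall g, H g -> isometric (act g)].

Definition cocompact_on H (X : metricType R) (act : G -> X -> X) :=
  exists2 K : set X, compact K &
    forall x, exists g k, [/\ H g, K k & x = act g k].

(** The elements of [H] of bounded displacement at [x] lie in finitely many
    cosets of [N]: this is properness of [H / N] on bounded sets, stated before
    [N] acts trivially. *)
Definition proper_mod H N (X : metricType R) (act : G -> X -> X) :=
  forall (x : X) (r : R), exists2 F : set G, finite_set F &
    forall g, H g -> mdist x (act g x) <= r -> exists2 n, N n & F (g * n)%g.

(** The invariant of the construction.  When [N] acts trivially, such a model is
    a geometric action of [H / N] on a CAT(0) space. *)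
Definition geometric_model H N (X : metricType R) (act : G -> X -> X) :=
  [/\ [set: X] !=set0, cn_space X, acts_isometrically H act,
      cocompact_on H act & proper_mod H N act].

Lemma actK H (X : metricType R) (act : G -> X -> X) g :
  is_subgroup H -> acts_isometrically H act -> H g ->
  cancel (act g) (act g^-1%g).
Proof. by move=> [_ _ HV] [a1 aM _] Hg x; rewrite -aM ?mulVg//; exact: HV. Qed.

Lemma actVK H (X : metricType R) (act : G -> X -> X) g :
  is_subgroup H -> acts_isometrically H act -> H g ->
  cancel (act g^-1%g) (act g).
Proof. by move=> [_ _ HV] [a1 aM _] Hg x; rewrite -aM ?mulgV//; exact: HV. Qed.

Section Restriction.
Context (H N : set G) (X : metricType R) (act : G -> X -> X) (Y : set X).

Let act_sub (g : G) (y : metric_sub Y) : metric_sub Y :=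
  insubd (y : {x : X | x \in Y}) (act g (sval y)).

(** The axioms are asked for on [Y] only, so that the action may be given by a
    formula that is an action on a convex subset but not on [X]. *)
Lemma restrict_model : is_subgroup H -> cn_space X -> Y !=set0 ->
  (forall x y t, Y x -> Y y -> 0 <= t <= 1 -> Y (seg x y t)) ->
  (forall g x, H g -> Y x -> Y (act g x)) ->
  (forall x, Y x -> act 1%g x = x) ->
  (forall g h x, H g -> H h -> Y x -> act (g * h)%g x = act g (act h x)) ->
  (forall g x y, H g -> Y x -> Y y -> mdist (act g x) (act g y) = mdist x y) ->
  (exists2 K, compact K & K `<=` Y /\
    forall x, Y x -> exists g k, [/\ H g, K k & x = act g k]) ->
  (forall x r, Y x -> exists2 F : set G, finite_set F &
    forall g, H g -> mdist x (act g x) <= r -> exists2 n, N n & F (g * n)%g) ->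
  exists (X' : metricType R) (act' : G -> X' -> X') (i : X' -> X),
    [/\ geometric_model H N act',
        forall x y, mdist (i x) (i y) = mdist x y,
        forall x, Y (i x) &
        forall g x, H g -> i (act' g x) = act g (i x)].
Proof.
move=> [H1 HM HV] cnX [y0 Yy0] Yseg Yact a1 aM aI [K cK [KY HK]] prop.
pose i (y : metric_sub Y) : X := sval y.
have Yi y : Y (i y) by have := svalP y; rewrite inE.
have iact g y : H g -> i (act_sub g y) = act g (i y).
  move=> Hg; rewrite /i /act_sub; apply: (insubdK y).
  by rewrite -topredE /= inE; exact: Yact.
have lift x : Y x -> exists y, i y = x.
  by move=> Yx; exists (exist _ x (mem_set Yx)).
have iinj y y' : i y = i y' -> y = y' by exact: val_inj.
exists (metric_sub Y), act_sub, i; split => //; split.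
- by have [y _] := lift _ Yy0; exists y.
- move=> x y t t01; have [m im] := lift _ (Yseg _ _ t (Yi x) (Yi y) t01).
  exists m => p; have := segP cnX (i x) (i y) t01 (i p).
  by rewrite -im.
- split.
  + by move=> x; apply: iinj; rewrite iact// a1.
  + move=> g h Hg Hh x; apply: iinj; rewrite !iact ?aM//; exact: HM.
  + by move=> g Hg x y; rewrite !mdist_sub -!/(i _) !iact// aI.
- exists (i @^-1` K).
    apply: compact_isometric_preimage => // x Kx.
    by have [y yx] := lift _ (KY _ Kx); exists y.
  move=> y; have [g [k [Hg Kk yk]]] := HK _ (Yi y).
  have [k' ik'] := lift _ (KY _ Kk); exists g, k'; split => //.
    by rewrite /= ik'.
  by apply: iinj; rewrite iact// ik'.
- move=> y r; have [F Ffin FP] := prop (i y) r (Yi y); exists F => // g Hg.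
  by rewrite mdist_sub -!/(i _) iact//; exact: FP.
Qed.

End Restriction.

(** * Properness and finite generation *)

(** The words have [m + 1] letters, because a subdivision into [m] pieces leaves
    a last factor that moves a point of [K] to a point of [K]. *)
Fixpoint words (S : set G) m : set G :=
  if m is m'.+1 then [set (s * w)%g | s in S & w in words S m'] else S.

Lemma finite_words (S : set G) m : finite_set S -> finite_set (words S m).
Proof. by move=> fS; elim: m => //= m IHm; exact: finite_image2. Qed.

Lemma words_ind (S : set G) (P : G -> Prop) : (forall s, S s -> P s) ->
  (forall g h, P g -> P h -> P (g * h)%g) ->
  forall m g, words S m g -> P g.
Proof.
move=> PS PM; elim=> [|m IHm] g /=; first exact: PS.
by move=> [s Ss [w /IHm Pw <-]]; apply: PM => //; exact: PS.
Qed.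

Definition transporter H (X : metricType R) (act : G -> X -> X) (K : set X)
    (e : R) : set G :=
  [set g | H g /\ exists k k', [/\ K k, K k' & mdist k (act g k') <= e]].

(** The Milnor-Schwarz argument: subdivide the segment from [k] to [act g k']
    into pieces of length at most [e], and move every point of the subdivision
    into [K]. *)
Lemma transporter_words H (X : metricType R) (act : G -> X -> X) (K : set X)
    (e : R) : is_subgroup H -> cn_space X -> acts_isometrically H act ->
  (forall x, exists g k, [/\ H g, K k & x = act g k]) -> 0 <= e ->
  forall m, transporter H act K (m%:R * e) `<=` words (transporter H act K e) m.
Proof.
move=> sH cnX aH HK e0; have [H1 HM HV] := sH; have [a1 aM aI] := aH.
elim=> [|m IHm] g [Hg [k [k' [Kk Kk' d]]]].
  by split => //; exists k, k'; split => //; rewrite (le_trans d)// mul0r.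
have m0 : 0 < m.+1%:R :> R by rewrite ltr0n.
have t01 : 0 <= (m.+1%:R^-1 : R) <= 1 by rewrite invr_ge0 ltW//= invf_le1// ler1n.
pose p := seg k (act g k') m.+1%:R^-1.
have [h [k'' [Hh Kk'' pk]]] := HK p.
have d1 : mdist k p <= e.
  by rewrite /p seg_distl// mulrC ler_pdivrMr// mulrC.
have d2 : mdist p (act g k') <= m%:R * e.
  rewrite /p seg_distr// -(ler_pM2l m0) mulrA mulrBr mulr1 divff ?gt_eqF//.
  rewrite -natr1 addrK mulrCA ler_wpM2l ?ler0n//.
  by rewrite natr1.
exists h; first by split => //; exists k, k''; rewrite -pk.
exists (h^-1 * g)%g; last by rewrite mulVKg.
apply: IHm; split; first by apply: HM => //; exact: HV.
exists k'', k'; split => //.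
rewrite -(aI _ Hh) -pk -aM//; last by apply: HM => //; exact: HV.
by rewrite mulVKg.
Qed.

Lemma finite_transporter H N (X : metricType R) (act : G -> X -> X) K (c : R) :
  acts_isometrically H act -> proper_mod H N act -> compact K ->
  exists2 F : set G, finite_set F &
    forall g, transporter H act K c g -> exists2 n, N n & F (g * n)%g.
Proof.
move=> [_ _ aI] prop cK.
have [[k0 Kk0]|nK] := pselect (K !=set0); last first.
  by exists set0 => // g [_ [k [_ [Kk _ _]]]]; case: nK; exists k.
have [D DP] := compact_dist_bounded k0 cK.
have [F Ffin FP] := prop k0 (D + c + D); exists F => // g [Hg [k [k' [Kk Kk' d]]]].
apply: FP => //.
have := metric_triangle k0 k (act g k0).
have := metric_triangle k (act g k') (act g k0).
rewrite aI// (metric_sym k' k0); have := DP _ Kk; have := DP _ Kk'; lra.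
Qed.

Lemma mod_trivial (F : set G) g :
  (exists2 n, [set 1%g] n & F (g * n)%g) -> F g.
Proof. by move=> [_ ->]; rewrite mulg1. Qed.

Lemma le_natmul_pos (c e : R) : 0 < e -> exists m : nat, c <= m%:R * e.
Proof.
move=> e0; exists (Num.bound (`|c| / e)); rewrite -ler_pdivrMr//.
have := archi_boundP (divr_ge0 (normr_ge0 c) (ltW e0)).
by move=> /ltW; apply: le_trans; rewrite ler_pM2r ?invr_gt0// ler_norm.
Qed.

(** Every element moves some point of [K] by a finite amount, hence is a word in
    the finite set of the elements that bring [K] within distance [1] of
    itself. *)
Lemma model_finitely_generated H (X : metricType R) (act : G -> X -> X) :
  is_subgroup H -> geometric_model H [set 1%g] act ->
  exists S : set G, [/\ finite_set S, S `<=` H &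
    forall g, H g -> exists m, words S m g].
Proof.
move=> sH [[x0 _] cnX aH [K cK HK] prop].
have [F Ffin FP] := finite_transporter 1 aH prop cK.
exists (transporter H act K 1); split.
- by apply: sub_finite_set Ffin => g /FP; exact: mod_trivial.
- by move=> g [].
- move=> g Hg; have [_ [k [_ Kk _]]] := HK x0.
  have [m mP] := @le_natmul_pos (mdist k (act g k)) 1 ltr01.
  exists m; apply: transporter_words => //.
  by split => //; exists k, k.
Qed.

Section ProperActions.
Context (X : metricType R) (act : G -> X -> X).
Context (aI : isometric_action act) (aP : proper_action act).

(** If [act g x] and [act g0 x] are both close to [y], then
    [(g * g0^-1)%g] moves some point near [y] to a point near [y]. *)
Lemma proper_action_local y K : compact K ->
  exists2 r : R, 0 < r &
    finite_set [set g | exists2 a, K a & mdist y (act g a) < r].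
Proof.
move=> cK; have [r0 r00 fin] := aP y; have [a1 aM aD] := aI.
pose r := r0 / 4; have rE : r0 = 4 * r by rewrite /r; field.
have rp : 0 < r by rewrite divr_gt0.
exists r => //.
apply: (compact_ind cK (P := fun A => finite_set
  [set g | exists2 a, A a & mdist y (act g a) < r])).
- by apply: (sub_finite_set _ (@finite_set0 G)) => g [].
- move=> A B fA fB; apply: (@sub_finite_set _ _
    ([set g | exists2 a, A a & mdist y (act g a) < r] `|`
     [set g | exists2 a, B a & mdist y (act g a) < r])).
    by move=> g [a [Aa|Ba] d]; [left|right]; exists a.
  by rewrite finite_setU.
- by move=> A B AB; apply: sub_finite_set => g [a /AB Ba d]; exists a.
- move=> x _; exists r => //.
  have [[g0 d0]|nx] := pselect (exists g, mdist y (act g x) < 2 * r).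
    apply: (sub_finite_set _ (finite_image (fun g => (g * g0)%g) fin)).
    move=> g [a]; rewrite ball_mdist => xa ya.
    exists (g * g0^-1)%g; last by rewrite mulgVK.
    exists (act g a); split; last by rewrite ball_mdist rE; lra.
    exists (act g0 a); last by rewrite -aM mulgVK.
    rewrite ball_mdist rE.
    have := metric_triangle y (act g0 x) (act g0 a); rewrite aD; lra.
  apply: (sub_finite_set _ (@finite_set0 G)) => g [a].
  rewrite ball_mdist => xa ya; apply: nx; exists g.
  have := metric_triangle y (act g a) (act g x).
  by rewrite aD (metric_sym a x); lra.
Qed.

(** Near a point [y], half of the radius given by [proper_action_local] is left for
    the distance from [y] to the points of [K] around it; compactness makes the
    radius uniform. *)
Lemma proper_action_uniform K : compact K ->
  exists2 e : R, 0 < e & finite_set (transporter [set: G] act K e).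
Proof.
move=> cK.
pose near_sets A e := [set g | exists a k, [/\ A a, K k & mdist a (act g k) <= e]].
suff [e e0 fin] : exists2 e : R, 0 < e & finite_set (near_sets K e).
  by exists e => //; apply: sub_finite_set fin => g [].
apply: (compact_ind cK (P := fun A => exists2 e : R, 0 < e &
  finite_set (near_sets A e))).
- exists 1 => //; apply: (sub_finite_set _ (@finite_set0 G)).
  by move=> g [a [k []]].
- move=> A B [e e0 fA] [e' e'0 fB]; exists (Num.min e e').
    by rewrite lt_min e0.
  apply: (@sub_finite_set _ _ (near_sets A e `|` near_sets B e')).
    by move=> g [a [k [[Aa|Ba] Kk]]]; rewrite le_min => /andP[d d'];
      [left|right]; exists a, k.
  by rewrite finite_setU.
- move=> A B AB [e e0 fB]; exists e => //; apply: sub_finite_set fB.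
  by move=> g [a [k [/AB Ba Kk d]]]; exists a, k.
- move=> y _; have [r r0 fin] := proper_action_local y cK.
  exists (r / 2); first by rewrite divr_gt0.
  exists (r / 3); first by rewrite divr_gt0.
  apply: sub_finite_set fin => g [a [k []]]; rewrite ball_mdist => ya Kk d.
  exists k => //; have := metric_triangle y a (act g k); lra.
Qed.

End ProperActions.

(** Properness in the sense of small balls implies properness on bounded sets:
    by subdivision of segments, an element of bounded displacement is a bounded
    word in the finite set given by [proper_action_uniform]. *)
Lemma geometric_action_model (X : metricType R) (act : G -> X -> X) :
  CAT0_space X -> geometric_action act ->
  geometric_model [set: G] [set 1%g] act.
Proof.
move=> /CAT0_spaceP[X0 cnX] [aI aP [K cK GK]]; have [a1 aM aD] := aI.
have sT : is_subgroup [set: G] by [].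
have aT : acts_isometrically [set: G] act by split=> // g _; exact: aD.
have GK' x : exists g k, [/\ [set: G] g, K k & x = act g k].
  have : [set: X] x by [].
  by rewrite -GK => -[g _ [k Kk <-]]; exists g, k.
split => //; first by exists K.
move=> x r; have [g0 [k [_ Kk ->]]] := GK' x.
have [e e0 fin] := proper_action_uniform aI aP cK.
have [m mP] := le_natmul_pos r e0.
exists [set (g0 * w * g0^-1)%g | w in words (transporter [set: G] act K e) m].
  exact/finite_image/finite_words.
move=> g _ d; exists 1%g => //; exists (g0^-1 * g * g0)%g; last first.
  by rewrite mulg1 !mulgA mulgV mul1g mulgK.
apply: transporter_words => //; first exact: ltW.
split => //; exists k, k; split => //; rewrite (le_trans _ mP)//.
by rewrite -(aD g0) -aM !mulgA mulgV mul1g aM.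
Qed.

End Actions.

(** * Centralizers *)

Section Centralizers.
Context {R : realType} {G : groupType}.

Definition centralizer_of (L : seq G) : set G :=
  [set g | forall s, s \in L -> (g * s = s * g)%g].

Lemma centralizer_subgroup L : is_subgroup (centralizer_of L).
Proof.
split=> [s _|g h gL hL s sL|g gL s sL]; first by rewrite mulg1 mul1g.
  by rewrite -mulgA hL// mulgA gL// mulgA.
by apply: (@mulgI _ g); rewrite mulVKg mulgA gL// mulgK.
Qed.

Context (X : metricType R) (act : G -> X -> X).
Context (X0 : [set: X] !=set0) (cnX : cn_space X).
Context (aH : acts_isometrically [set: G] act).
Context (prop : proper_mod [set: G] [set 1%g] act).
Context (coc : cocompact_on [set: G] act).

(** Moved into a compact set, a point displaced by [s] at most [c s] is displaced
    as little by a conjugate of [s], of which there are finitely many; and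
    two elements that conjugate [s] to the same element differ by an element of
    the centralizer of [s]. *)
Lemma centralizer_cocompact (L : seq G) (c : G -> R) :
  exists2 K : set X, compact K & forall x,
    (forall s, s \in L -> mdist x (act s x) <= c s) ->
    exists g k, [/\ centralizer_of L g, K k & x = act g k].
Proof.
have [a1 aM aI] := aH.
elim: L => [|s L [K cK HK]].
  have [K cK HK] := coc; exists K => // x _.
  by have [g [k [_ Kk ->]]] := HK x; exists g, k.
have [F Ffin FP] := finite_transporter (c s) aH prop cK.
have [conjugator conjugatorP] : {conjugator : G -> G & forall h,
    (exists2 g, centralizer_of L g & (g * h = s * g)%g) ->
    centralizer_of L (conjugator h) /\ (conjugator h * h = s * conjugator h)%g}.
  apply: (@choice G G (fun h g' =>
    (exists2 g, centralizer_of L g & (g * h = s * g)%g) ->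
    centralizer_of L g' /\ (g' * h = s * g')%g)) => h.
  have [[g gL gh]|nh] := pselect (exists2 g, centralizer_of L g & (g * h = s * g)%g).
    by exists g.
  by exists 1%g.
have [l Fl] := (finite_seqP F).1 Ffin.
exists (\big[setU/set0]_(h <- l) (act (conjugator h) @` K)).
  apply: bigsetU_compact => h _.
  by apply: compact_lipschitz_image cK; [exact: ltr01 | apply/isometric_lipschitz/aI].
move=> x xsL.
have [g [k [gL Kk xk]]] := HK x (fun s' s'L => xsL s' (mem_behead (s := s :: L) s'L)).
pose h := (g^-1 * s * g)%g.
have gh : (g * h = s * g)%g by rewrite /h -mulgA mulVKg.
have [cL ch] := conjugatorP h (ex_intro2 _ _ g gL gh).
have [_ CM CV] := centralizer_subgroup L.
exists (g * (conjugator h)^-1)%g, (act (conjugator h) k); split.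
- move=> s'; rewrite inE => /orP[/eqP->|s'L]; last first.
    by apply: CM => //; exact: CV.
  apply: (@mulIg _ (conjugator h)); rewrite -[RHS]mulgA mulgVK -gh -!mulgA -ch.
  by rewrite mulKg.
- rewrite -bigcup_seq; exists h; last by exists k.
  suff : F h by rewrite Fl.
  apply: mod_trivial; apply: FP; split => //.
  exists k, k; split => //; rewrite -(aI g I) -aM// gh aM// -xk.
  by apply: xsL; rewrite inE eqxx.
- by rewrite -aM// mulgVK.
Qed.

(** The centralizer acts on the points that every element of [L] displaces at most
    as much as it displaces a chosen point. *)
Lemma centralizer_model (L : seq G) :
  exists (X' : metricType R) (act' : G -> X' -> X'),
    geometric_model (centralizer_of L) [set 1%g] act'.
Proof.
have [a1 aM aI] := aH; have [x0 _] := X0.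
pose Y : set X := [set x | forall s, s \in L ->
  mdist x (act s x) <= mdist x0 (act s x0)].
have [K cK HK] := centralizer_cocompact L (fun s => mdist x0 (act s x0)).
have Yact g x : centralizer_of L g -> Y (act g x) <-> Y x.
  move=> gL; have E s : s \in L ->
      mdist (act g x) (act s (act g x)) = mdist x (act s x).
    by move=> sL; rewrite -aM// -gL// aM// aI.
  by split=> h s sL; have := h s sL; rewrite E.
have clY : closed Y.
  have -> : Y = \bigcap_(s in [set` L])
      [set x | mdist x (act s x) <= mdist x0 (act s x0)].
    by apply/seteqP; split.
  apply: closed_bigI => s _; apply: (@closed_lipschitz_le _ _ 2) => //.
  exact/displacement_lipschitz/aI.
have [||||||||||X' [act' [i [model _ _ _]]]] :=
  @restrict_model R G (centralizer_of L) [set 1%g] X act Y.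
- exact: centralizer_subgroup.
- exact: cnX.
- by exists x0.
- move=> x y t Yx Yy t01 s sL; apply: displacement_convex => //.
  + exact: aI.
  + exact: Yx.
  + exact: Yy.
- by move=> g x gL Yx; apply/Yact.
- by move=> x _.
- by move=> g h x _ _ _; apply: aM.
- by move=> g x y _ _ _; apply: aI.
- exists (K `&` Y); first exact: compact_closedI.
  split; first by move=> x [].
  move=> x Yx; have [g [k [gL Kk xk]]] := HK x Yx; exists g, k; split => //.
  by split => //; apply/(Yact g) => //; rewrite -xk.
- move=> x r _; have [F Ffin FP] := prop x r; exists F => // g _.
  exact: FP.
by exists X', act'.
Qed.

End Centralizers.

(** * Dividing by a central element *)

Section CentralQuotient.
Context {R : realType} {G : groupType} (H N : set G).
Context (sH : is_subgroup H) (sN : is_subgroup N) (NH : N `<=` H).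
Context (NC : forall n g, N n -> H g -> (n * g = g * n)%g).

(** The displacement of a central element is [H]-invariant, so that its minimum
    over a compact fundamental set is a global one. *)
Lemma min_displacement_model (X : metricType R) (act : G -> X -> X) z : N z ->
  geometric_model H N act ->
  exists (X' : metricType R) (act' : G -> X' -> X') (l : R),
    [/\ geometric_model H N act', forall x, mdist x (act' z x) = l &
        forall w, H w -> (forall x, act w x = x) -> forall x, act' w x = x].
Proof.
move=> Nz [[x0 _] cnX aH [K cK HK] prop]; have [a1 aM aI] := aH.
have Hz := NH Nz; have Iz := aI _ Hz.
have K0 : K !=set0 by have [_ [k [_ Kk _]]] := HK x0; exists k.
have [m Km mmin] := compact_lipschitz_min cK K0 (ltr0Sn R 1)
  (displacement_lipschitz Iz).
pose l := mdist m (act z m).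
have dact g x : H g -> mdist (act g x) (act z (act g x)) = mdist x (act z x).
  by move=> Hg; rewrite -aM// (NC Nz Hg) aM// aI.
have lle x : l <= mdist x (act z x).
  by have [g [k [Hg Kk ->]]] := HK x; rewrite dact//; exact: mmin.
pose Y : set X := [set x | mdist x (act z x) <= l].
have clY : closed Y.
  by apply: (@closed_lipschitz_le _ _ 2) => //; exact: displacement_lipschitz.
have [||||||||||X' [act' [i [model Ii Yi iact]]]] :=
  @restrict_model R G H N X act Y.
- exact: sH.
- exact: cnX.
- by exists m; rewrite /Y /=.
- by move=> x y t Yx Yy t01; apply: displacement_convex.
- by move=> g x Hg Yx; rewrite /Y /= dact.
- by move=> x _.
- by move=> g h x Hg Hh _; apply: aM.
- by move=> g x y Hg _ _; apply: aI.
- exists (K `&` Y); first exact: compact_closedI.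
  split; first by move=> x [].
  move=> x Yx; have [g [k [Hg Kk xk]]] := HK x; exists g, k; split => //.
  by split => //; rewrite /Y /= -(dact g k Hg) -xk; exact: Yx.
- by move=> x r _; exact: prop.
exists X', act', l; split => //.
  by move=> x; rewrite -Ii iact//; apply/eqP; rewrite eq_le lle andbT; exact: Yi.
by move=> w Hw wx x; apply: mdist_positivity; rewrite -Ii iact// wx mdistxx.
Qed.

Section Translation.
Context (X : metricType R) (act : G -> X -> X) (z : G) (l : R).
Context (Nz : N z) (model : geometric_model H N act).
Context (l0 : 0 < l) (zl : forall x, mdist x (act z x) = l).

Let aH : acts_isometrically H act. Proof. by case: model. Qed.
Let cnX : cn_space X. Proof. by case: model. Qed.
Let aM : forall g h, H g -> H h -> forall x, act (g * h)%g x = act g (act h x).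
Proof. by case: aH. Qed.
Let aI : forall g, H g -> isometric (act g). Proof. by case: aH. Qed.
Let Hz : H z := NH Nz.
Let Iz : isometric (act z) := aI Hz.
Let zK : cancel (act z) (act z^-1%g). Proof. exact: (actK sH aH Hz). Qed.
Let zVK : cancel (act z^-1%g) (act z). Proof. exact: (actVK sH aH Hz). Qed.

Let T : R -> X -> X := flow (act z) (act z^-1%g) l.

Let TD s t x : T s (T t x) = T (s + t) x.
Proof. exact: (flowD cnX Iz zVK l0 zl). Qed.
Let T0 x : T 0 x = x.
Proof. exact: (flow0 cnX Iz zVK l0 zl). Qed.
Let IT t : isometric (T t).
Proof. exact: (flow_isometry cnX Iz zVK l0 zl). Qed.
Let dT t x : mdist x (T t x) = `|t|.
Proof. exact: (dist_flow cnX Iz zVK l0 zl). Qed.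
Let Tact g t x : H g -> T t (act g x) = act g (T t x).
Proof.
move=> Hg; apply: (flow_comm cnX Iz zK zVK l0 zl) => // [|y]; first exact: aI.
by rewrite -!aM// (NC Nz Hg).
Qed.
Let Tl x : T l x = act z x.
Proof. exact: (flow_f cnX Iz zVK l0 zl). Qed.

(** Flowing by a multiple of [l] is acting by a power of [z]. *)
Lemma flow_near_N t : exists w s, [/\ N w, `|t - s| <= l &
  forall x, T s x = act w x].
Proof.
have [_ _ NV] := sN; have [a1 _ _] := aH.
have pow n x : T (n%:R * l) x = act (z ^+ n)%g x.
  elim: n => [|n IHn]; first by rewrite mul0r T0 expg0 a1.
  rewrite expgS aM//; last exact/NH/(subgroup_expg _ sN Nz).
  by rewrite -IHn -Tl TD -natr1 mulrDl mul1r addrC.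
have nat r : 0 <= r -> exists n : nat, `|r - n%:R * l| <= l.
  move=> r0; have rl : 0 <= r / l by rewrite divr_ge0// ltW.
  exists (Num.truncn (r / l)); have := truncn_itv rl => /andP[h1 h2].
  rewrite ler_pdivlMr// in h1; rewrite ltr_pdivrMr// in h2.
  by rewrite ler_norml; move: h2; rewrite -natr1 mulrDl; lra.
have [t0|t0] := leP 0 t.
  have [n nP] := nat t t0; exists (z ^+ n)%g, (n%:R * l); split => //.
  exact: (subgroup_expg _ sN Nz).
have [n nP] := nat (- t) ltac:(by rewrite oppr_ge0 ltW).
exists (z ^+ n)^-1%g, (- (n%:R * l)); split.
- exact/NV/(subgroup_expg _ sN Nz).
- by rewrite -normrN opprD opprK.
- move=> x; have Hn : H (z ^+ n)%g by exact/NH/(subgroup_expg _ sN Nz).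
  by rewrite -[LHS](actK sH aH Hn) -pow TD addrN T0.
Qed.

(** On the zero set of the Busemann function [b] of the flow line of [x0], let [g]
    act by [act g] followed by the flow back to the zero set.  As [b] changes by a
    constant under [act g], the time of this flow does not depend on the point, so
    the new action is by isometries.  The flow commutes with [act g], which gives
    the composition law.  Properness is not lost, because up to a bounded distance
    the flow back is the action of an element of [N]. *)
Lemma level_set_model :
  exists (X' : metricType R) (act' : G -> X' -> X'),
    [/\ geometric_model H N act', forall x, act' z x = x &
        forall w, H w -> (forall x, act w x = x) -> forall x, act' w x = x].
Proof.
have [[x0 _] _ _ [K cK HK] prop] := model; have [a1 _ _] := aH.
have [H1 HM HV] := sH.
pose b x := busemann T x x0.
have bT s x : b (T s x) = b x - s by exact: (busemann_flow TD T0 IT dT).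
have bact g x : H g -> b (act g x) = b x + b (act g x0).
  move=> Hg; rewrite /b (busemann_cocycle cnX TD IT dT _ (act g x0)).
  rewrite (busemann_isometry _ _ (aI Hg))// => t y; exact: Tact.
pose act2 g x := T (b (act g x)) (act g x).
pose Y : set X := [set x | b x = 0].
have act2E g x : H g -> Y x -> act2 g x = T (b (act g x0)) (act g x).
  by move=> Hg Yx; rewrite /act2 bact// Yx add0r.
(* The retraction along the flow intertwines the two actions; it carries a compact
   fundamental set to one for the new action. *)
pose pi x := T (b x) x.
have pi_lip x y : mdist (pi x) (pi y) <= 2 * mdist x y.
  have := metric_triangle (pi x) (T (b x) y) (pi y).
  rewrite /pi IT.
  have -> : T (b y) y = T (b y - b x) (T (b x) y) by rewrite TD subrK.
  rewrite dT.
  have : `|b y - b x| <= mdist x y.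
    have h1 := busemann_lipschitz cnX TD T0 IT dT x y x0.
    have h2 := busemann_lipschitz cnX TD T0 IT dT y x x0.
    rewrite (metric_sym y x) in h2.
    by rewrite ler_norml /b; apply/andP; split; lra.
  lra.
have Ypi x : Y (pi x) by rewrite /Y /= bT subrr.
have act2pi g x : H g -> act2 g (pi x) = pi (act g x).
  by move=> Hg; rewrite /act2 -[act g (pi x)]Tact// bT TD subrK.
have piY x : Y x -> pi x = x by rewrite /pi => ->.
have bx0 : b x0 = 0.
  by have := busemann_antisym cnX TD IT dT x0 x0; rewrite /b; lra.
have [||||||||||X' [act' [i [model' Ii Yi iact]]]] :=
  @restrict_model R G H N X act2 Y.
- exact: sH.
- exact: cnX.
- by exists x0.
- move=> x y t Yx Yy t01; rewrite /Y /= /b.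
  by rewrite (busemann_affine cnX TD IT dT)// -!/(b _) Yx Yy !mulr0 addr0.
- by move=> g x _ _; exact: Ypi.
- by move=> x Yx; rewrite /act2 a1; exact: piY.
- by move=> g h x Hg Hh _; rewrite act2pi// /act2 aM.
- by move=> g x y Hg Yx Yy; rewrite !act2E// IT aI.
- exists (pi @` K); first exact: compact_lipschitz_image pi_lip cK.
  split; first by move=> _ [x _ <-].
  move=> x Yx; have [g [k [Hg Kk xk]]] := HK x; exists g, (pi k); split => //.
  by rewrite act2pi// -xk piY.
- move=> x r Yx; have [F Ffin FP] := prop x (r + l); exists F => // g Hg d.
  have [w [s [Nw ws wP]]] := flow_near_N (b (act g x)).
  have Hw := NH Nw.
  have [||n Nn Fn] := FP (w * g)%g.
  + exact: HM.
  + rewrite aM// -wP; apply: le_trans (metric_triangle _ (act2 g x) _) _.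
    apply: lerD => //; rewrite /act2 -(IT (- s)) !TD addNr T0 metric_sym dT.
    by rewrite addrC.
  + have [_ NM _] := sN; exists (w * n)%g; first exact: NM.
    by rewrite mulgA -(NC Nw Hg).
exists X', act'; split => // [x|w Hw wx x];
  apply: mdist_positivity; rewrite -Ii iact//.
- rewrite /act2 -[act z _]Tl bT.
  by rewrite TD subrK Yi T0 mdistxx.
- by rewrite /act2 wx Yi T0 mdistxx.
Qed.

End Translation.

(** The minimal displacement [l] of [z] is zero, and then [z] is trivial on the
    minimal set, or positive, and then [z] translates along axes. *)
Lemma trivialize_central (X : metricType R) (act : G -> X -> X) z : N z ->
  geometric_model H N act ->
  exists (X' : metricType R) (act' : G -> X' -> X'),
    [/\ geometric_model H N act', forall x, act' z x = x &
        forall w, H w -> (forall x, act w x = x) -> forall x, act' w x = x].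
Proof.
move=> Nz /(min_displacement_model Nz)[X1 [act1 [l [model1 zl triv1]]]].
have [[x1 _] _ _ _ _] := model1.
have l_ge0 : 0 <= l by rewrite -(zl x1) mdist_ge0.
have [l0|l0] := eqVneq l 0.
  exists X1, act1; split => // x.
  by apply/esym/mdist_positivity; rewrite zl.
have lp : 0 < l by rewrite lt_neqAle eq_sym l0.
have [X2 [act2 [model2 z2 triv2]]] := level_set_model Nz model1 lp zl.
exists X2, act2; split => // w Hw wx.
exact/triv2/triv1.
Qed.

Lemma trivialize_central_seq (L : seq G) (X : metricType R) (act : G -> X -> X) :
  (forall z, z \in L -> N z) -> geometric_model H N act ->
  exists (X' : metricType R) (act' : G -> X' -> X'),
    geometric_model H N act' /\ forall z, z \in L -> forall x, act' z x = x.
Proof.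
move=> LN model; elim: L LN => [|z L IHL] LN; first by exists X, act.
have [X1 [act1 [model1 triv1]]] := IHL (fun z' h => LN z' (mem_behead (s := z :: L) h)).
have [X2 [act2 [model2 z2 triv2]]] :=
  trivialize_central (LN z (mem_head _ _)) model1.
exists X2, act2; split => // w; rewrite inE => /orP[/eqP->//|wL].
by apply: triv2 (triv1 _ wL); apply/NH/LN; rewrite inE wL orbT.
Qed.

End CentralQuotient.

(** * Product groups *)

Section Products.
Context {R : realType} {G1 G2 : groupType}.

Lemma CAT0_group_prod : CAT0_group R G1 -> CAT0_group R G2 ->
  CAT0_group R (G1 * G2)%type.
Proof.
move=> [X1 [act1 [/CAT0_spaceP[[x1 _] cn1] [[a1 aM1 aD1] aP1 [K1 cK1 GK1]]]]].
move=> [X2 [act2 [/CAT0_spaceP[[x2 _] cn2] [[a2 aM2 aD2] aP2 [K2 cK2 GK2]]]]].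
pose act (g : G1 * G2) (x : l2_prod X1 X2) : l2_prod X1 X2 :=
  (act1 g.1 x.1, act2 g.2 x.2).
exists (l2_prod X1 X2), act; split.
  apply/CAT0_spaceP; split; last exact: cn_space_l2.
  by exists ((x1, x2) : l2_prod X1 X2).
split.
- split.
  + by move=> [y1 y2]; rewrite /act /= a1 a2.
  + by move=> g h x; rewrite /act /= aM1 aM2.
  + move=> g x y; apply: ge0_sqr_inj; rewrite ?mdist_ge0// !sqr_mdist_l2 /=.
    by rewrite aD1 aD2.
- move=> x; have [r1 r10 fin1] := aP1 x.1; have [r2 r20 fin2] := aP2 x.2.
  exists (Num.min r1 r2); first by rewrite lt_min r10.
  apply: (sub_finite_set _ (finite_setX fin1 fin2)).
  move=> g [_ [[y + <-]]]; rewrite !ball_mdist !lt_min => /andP[d1 d2] /andP[e1 e2].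
  split.
    exists (act1 g.1 y.1); split; last first.
      by rewrite ball_mdist (le_lt_trans (mdist_l2_fst _ (act g y))).
    by exists y.1 => //; rewrite ball_mdist (le_lt_trans (mdist_l2_fst _ _)).
  exists (act2 g.2 y.2); split; last first.
    by rewrite ball_mdist (le_lt_trans (mdist_l2_snd _ (act g y))).
  by exists y.2 => //; rewrite ball_mdist (le_lt_trans (mdist_l2_snd _ _)).
- exists [set x | K1 x.1 /\ K2 x.2]; first exact: compact_l2_prod.
  apply/seteqP; split => // -[y1 y2] _.
  have : [set: X1] y1 by []. rewrite -GK1 => -[g1 _ [k1 Kk1 <-]].
  have : [set: X2] y2 by []. rewrite -GK2 => -[g2 _ [k2 Kk2 <-]].
  by exists (g1, g2) => //; exists (k1, k2).
Qed.

Lemma CAT0_group_swap :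
  CAT0_group R (G1 * G2)%type -> CAT0_group R (G2 * G1)%type.
Proof.
move=> [X [act [catX [[a1 aM aD] aP [K cK GK]]]]].
exists X, (fun g => act (g.2, g.1)); split => //; split.
- by split=> [x|g h x|g x y]; rewrite ?a1 ?aD// -aM.
- move=> x; have [r r0 fin] := aP x; exists r => //.
  apply: (sub_finite_set _ (finite_image (fun g => (g.2, g.1)) fin)).
  by move=> [g2 g1] h; exists (g1, g2).
- exists K => //; apply/seteqP; split => // x _.
  have : [set: X] x by []. rewrite -GK => -[[g1 g2] _ xK].
  by exists (g2, g1).
Qed.

(** [H] is [G1 * Z(G2)] and [N] is [1 * Z(G2)], described as the elements of [H]
    with trivial first component.  Both [G] and [H] are finitely generated; the
    first fact makes [H] the centralizer of a finite list, the second reduces the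
    triviality of [N] to that of finitely many of its elements. *)
Lemma CAT0_group_factor : CAT0_group R (G1 * G2)%type -> CAT0_group R G1.
Proof.
pose G : groupType := (G1 * G2)%type.
pose snd_part (g : G) : G := (1%g, g.2).
move=> [X [act [catX geo]]].
have model := geometric_action_model catX geo; have [X0 cnX aH coc prop] := model.
have sT : is_subgroup [set: G] by [].
have [S [/finite_seqP[L ->] _ SG]] := model_finitely_generated sT model.
pose L2 := map snd_part L; pose H := centralizer_of L2.
have sH : is_subgroup H := centralizer_subgroup L2.
have HP g : H g <-> forall a, (g.2 * a = a * g.2)%g.
  split=> [Hg a|ga s /mapP[s' _ ->]]; last first.
    by rewrite [LHS]surjective_pairing [RHS]surjective_pairing /= ga mulg1 mul1g.
  have [m] := SG (1%g, a) I.
  apply: (@words_ind _ _ (fun s : G => (g.2 * s.2 = s.2 * g.2)%g)) => [s Ls|s s' h h'].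
    by have /(congr1 snd) := Hg _ (map_f snd_part Ls).
  by rewrite /= mulgA h -mulgA h' mulgA.
have [X1 [act1 model1]] := centralizer_model X0 cnX aH prop coc L2.
pose N : set G := [set n | n.1 = 1%g /\ H n].
have sN : is_subgroup N.
  have [H1 HM HV] := sH; split=> [//|g h [g1 Hg] [h1 Hh]|g [g1 Hg]].
  + by split; [rewrite /= g1 h1 mulg1 | exact: HM].
  + by split; [rewrite /= g1 invg1 | exact: HV].
have NH : N `<=` H by move=> n [].
have NC n g : N n -> H g -> (n * g = g * n)%g.
  move=> [n1 /HP nC] _.
  by rewrite [LHS]surjective_pairing [RHS]surjective_pairing /= n1 mul1g mulg1 nC.
have [S' [/finite_seqP[L' ->] S'H S'G]] := model_finitely_generated sH model1.
have modelN : geometric_model H N act1.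
  have [X10 cnX1 aH1 coc1 prop1] := model1; split => // x r.
  have [F Ffin FP] := prop1 x r; exists F => // g Hg d.
  have [n n1 Fn] := FP g Hg d; exists n => //.
  by rewrite n1; have [] := sN.
have L'N z : z \in map snd_part L' -> N z.
  by move=> /mapP[s /S'H/HP sC ->]; split => //; apply/HP.
have [X2 [act2 [model2 triv]]] := trivialize_central_seq sH sN NH NC L'N modelN.
have [X20 cnX2 aH2 [K cK HK] prop2] := model2; have [b1 bM bI] := aH2.
(* A word in the generators of [H] that represents an element of [N] is the word in
   their second components, which act trivially. *)
have Ntriv n x : N n -> act2 n x = x.
  move=> [n1 Hn]; have [m] := S'G n Hn.
  suff P g : words [set` L'] m g -> H (snd_part g) /\
      forall y, act2 (snd_part g) y = y.
    by move=> /P[_]; rewrite /snd_part -n1 -surjective_pairing; exact.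
  move: m g; apply: words_ind => [s Ls|g h [Hg gt] [Hh ht]].
    have Ls' := map_f snd_part Ls.
    by split; [exact/NH/L'N | exact: triv].
  have -> : snd_part (g * h)%g = (snd_part g * snd_part h)%g.
    by rewrite [RHS]surjective_pairing /= mulg1.
  have [_ HM _] := sH; split; first exact: HM.
  by move=> y; rewrite bM// ht gt.
have H1 (g : G1) : H (g, 1%g) by apply/HP => a; rewrite mulg1 mul1g.
exists X2, (fun g => act2 (g, 1%g)); split; first exact/CAT0_spaceP.
split.
- split=> [x|g h x|g x y]; [exact: b1| |exact: bI].
  by rewrite -bM//; congr act2; rewrite [RHS]surjective_pairing /= mulg1.
- move=> x; have [F Ffin FP] := prop2 x 2; exists 1 => //.
  apply: (sub_finite_set _ (finite_image fst Ffin)).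
  move=> g [_ [[y + <-]]]; rewrite !ball_mdist => xy xgy.
  have [||n [n1 _] Fn] := FP (g, 1%g).
  + exact: H1.
  + have := metric_triangle x (act2 (g, 1%g) y) (act2 (g, 1%g) x).
    rewrite bI// (metric_sym y x); lra.
  + by exists ((g, 1%g) * n)%g => //=; rewrite n1 mulg1.
- exists K => //; apply/seteqP; split => // x _.
  have [[g a] [k [Hg Kk ->]]] := HK x; exists g => //; exists k => //.
  have Na : N (1%g, a) by split => //; apply/HP; exact/(HP (g, a)).
  rewrite -[in LHS](Ntriv _ k Na) -bM//; last exact: NH.
  by congr act2; rewrite [LHS]surjective_pairing /= mulg1 mul1g.
Qed.

End Products.

Theorem theorem5 (R : realType) (G1 G2 : groupType) :
  (CAT0_group R G1 /\ CAT0_group R G2) <-> CAT0_group R (G1 * G2)%type.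
Proof.
split=> [[]|h]; first exact: CAT0_group_prod.
split; first exact: CAT0_group_factor h.
exact/CAT0_group_factor/CAT0_group_swap/h.
Qed.
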